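(* Let $n\geq 2$ and let $L$ be any local field, with algebraic closure $\bar{L}$. For $\varepsilon\in L^*$ let $G_\varepsilon=(g_1,\ldots,g_n)$ be the $(n+2)$-nomial $n\times n$ system given by $$g_1=x_1x_2-\left(\varepsilon+x_1^2\right),\qquad g_i=x_ix_{i+1}-\left(1+\varepsilon^{2i-3}x_1^2\right)\ \ (2\leq i\leq n-1),\qquad g_n=x_n-\left(1+\varepsilon^{2n-3}x_1^2\right).$$ Then for any $\varepsilon\in L^*$ with generalized phase $1$ and $\mathrm{ord}\,\varepsilon$ sufficiently large, the roots of $G_\varepsilon$ in $\bar{L}^n$ are all non-degenerate, lie in $(L^* )^n$, and have generalized phase $1$ for all their coordinates. In particular, $G_\varepsilon$ has exactly $n+1$ non-degenerate roots in $\mathbb{R}_+^n$, $(\mathbb{Q}_p^* )^n$, or $(\mathbb{F}_q((t))^* )^n$ (each with generalized phase $1$ for all its coordinates), according as $\varepsilon$ is $1/4$, $p$, or $t$ (here $p$ is any prime and $q$ any prime power).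
   Context: A local field $L$ means: $\mathbb{C}$, $\mathbb{R}$, any finite algebraic extension of $\mathbb{Q}_p$ ($p$ prime), or $\mathbb{F}_q((t))$ ($q$ a prime power). An $(n+k)$-nomial $n\times n$ system over $L$ is a tuple $(f_1,\ldots,f_n)$ of Laurent polynomials in $L[x_1^{\pm1},\ldots,x_n^{\pm1}]$ whose monomial term expansions involve a total of $n+k$ distinct exponent vectors. A root is non-degenerate if the Jacobian matrix at it has rank $n$. $\mathbb{R}_+^n$ is the (open) positive orthant. Generalized phase: for $y\in L^*$ with $L\in\{\mathbb{R},\mathbb{C}\}$, $\phi(y):=y/|y|$, and one defines $\mathrm{ord}\, y:=-\log|y|$. For $L$ non-Archimedean, let $\mathfrak{M}$ be the maximal ideal of the ring of integers of $L$, fix a uniformizer $\rho$ (a generator of $\mathfrak{M}$), let $\mathrm{ord}$ be the corresponding valuation (so $\mathrm{ord}\,\rho=1$), and set $\phi(y):=\frac{y}{\rho^{\mathrm{ord}\, y}}\bmod \mathfrak{M}$. For $\mathbb{Q}_p$ with $\varepsilon=p$ and $\mathbb{F}_q((t))$ with $\varepsilon=t$, the uniformizer is $p$, respectively $t$. ''Sufficiently large'' means larger than some bound depending on $n$ and $L$. *)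

(* Defs.v *)
From HB Require Import structures.
From mathcomp Require Import all_boot all_order all_algebra all_field fraction.
From mathcomp Require Import complex.
From mathcomp Require Import boolp classical_sets cardinality reals exp.
(* The notations of mpoly clash with those of MathComp-Analysis. *)
From mathcomp Require Import -(notations) mpoly.

Set Implicit Arguments.
Unset Strict Implicit.
Unset Printing Implicit Defensive.

Import Order.TTheory GRing.Theory Num.Theory.
Local Open Scope classical_set_scope.
Local Open Scope ring_scope.

(* Classical units and inverses, used to make the two rings below integral
   domains in the sense of the hierarchy. *)
Section ClassicalUnit.
Variable A : comNzRingType.

Definition cunit : pred A := fun x => `[< exists y, y * x = 1 >].
Definition cinv (x : A) : A := xget x [set y | y * x = 1].

Lemma cmulVx : {in cunit, left_inverse 1 cinv *%R}.
Proof. by move=> x /asboolP[y yx]; rewrite /cinv; case: xgetP => [z _ //|/(_ y)]. Qed.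

Lemma cunitPl (x y : A) : y * x = 1 -> cunit x.
Proof. by move=> yx; apply/asboolP; exists y. Qed.

Lemma cinv_out : {in [predC cunit], cinv =1 id}.
Proof.
move=> x; rewrite inE => /asboolPn xN; rewrite /cinv; case: xgetP => // y _ yx.
by case: xN; exists y.
Qed.
End ClassicalUnit.

Definition padic_coherent (p : nat) (x : forall k, 'Z_(p ^ k.+1)) : Prop :=
  forall k, (x k.+1 : nat)%:R = x k.

(* Z_p as the inverse limit of the rings Z/p^(k+1), k >= 0. The primality proof
   is a parameter of the type so that the ring instances below, which need it,
   can be inferred. *)
Record padic_int (p : nat) (p_pr : prime p) := PadicInt {
  padic_res :> forall k, 'Z_(p ^ k.+1);
  _ : padic_coherent padic_res }.

Section PadicInt.
Variables (p : nat) (p_pr : prime p).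
Local Notation padic_int := (padic_int p_pr).
Local Notation PadicInt := (PadicInt p_pr).
Local Notation padic_coherent := (@padic_coherent p).

Lemma padic_resP (x : padic_int) : padic_coherent x. Proof. by case: x. Qed.

Lemma padic_intP (x y : padic_int) : (forall k, x k = y k) -> x = y.
Proof.
case: x y => [x xP] [y yP] /= xy.
have E : x = y by exact: functional_extensionality_dep.
by move: xP yP; rewrite E => xP yP; congr PadicInt; exact: Prop_irrelevance.
Qed.

HB.instance Definition _ := gen_eqMixin padic_int.
HB.instance Definition _ := gen_choiceMixin padic_int.

Lemma padic_pow_gt1 k : (1 < p ^ k.+1)%N.
Proof. by rewrite -{1}(expn0 p) ltn_exp2l // prime_gt1. Qed.

Lemma padic_natr_mod k j a : (k <= j)%N ->
  ((a %% p ^ j.+1)%:R : 'Z_(p ^ k.+1)) = a%:R.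
Proof.
move=> kj; rewrite -(Zp_nat_mod (padic_pow_gt1 k)) modn_dvdm ?Zp_nat_mod //.
  exact: padic_pow_gt1.
by rewrite dvdn_exp2l.
Qed.

Lemma padic_valD k (a b : 'Z_(p ^ k.+1)) :
  (a + b : 'Z_(p ^ k.+1)) = ((a + b) %% p ^ k.+1)%N :> nat.
Proof. by rewrite -[X in _ = (_ %% X)%N](Zp_cast (padic_pow_gt1 k)). Qed.

Lemma padic_valM k (a b : 'Z_(p ^ k.+1)) :
  (a * b : 'Z_(p ^ k.+1)) = ((a * b) %% p ^ k.+1)%N :> nat.
Proof. by rewrite -[X in _ = (_ %% X)%N](Zp_cast (padic_pow_gt1 k)). Qed.

Lemma padic_coherentD x y : padic_coherent x -> padic_coherent y ->
  padic_coherent (fun k => x k + y k).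
Proof.
by move=> xP yP k; rewrite padic_valD padic_natr_mod // natrD xP yP.
Qed.

Lemma padic_coherentM x y : padic_coherent x -> padic_coherent y ->
  padic_coherent (fun k => x k * y k).
Proof.
by move=> xP yP k; rewrite padic_valM padic_natr_mod // natrM xP yP.
Qed.

Lemma padic_coherent_nat m : padic_coherent (fun=> m%:R).
Proof.
by move=> k; rewrite val_Zp_nat ?padic_pow_gt1 // padic_natr_mod.
Qed.

Lemma padic_coherentN x : padic_coherent x -> padic_coherent (fun k => - x k).
Proof.
move=> xP k; apply/eqP; rewrite -subr_eq0 opprK -(xP k) -natrD.
by rewrite -(@padic_natr_mod k k.+1) // -padic_valD addNr.
Qed.

Definition padic_nat m := PadicInt (padic_coherent_nat m).
Definition padic_add (x y : padic_int) :=
  PadicInt (padic_coherentD (padic_resP x) (padic_resP y)).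
Definition padic_mul (x y : padic_int) :=
  PadicInt (padic_coherentM (padic_resP x) (padic_resP y)).
Definition padic_opp (x : padic_int) :=
  PadicInt (padic_coherentN (padic_resP x)).

Fact padic_addA : associative padic_add.
Proof. by move=> x y z; apply: padic_intP => k /=; rewrite addrA. Qed.
Fact padic_addC : commutative padic_add.
Proof. by move=> x y; apply: padic_intP => k /=; rewrite addrC. Qed.
Fact padic_add0 : left_id (padic_nat 0) padic_add.
Proof. by move=> x; apply: padic_intP => k /=; rewrite add0r. Qed.
Fact padic_addN : left_inverse (padic_nat 0) padic_opp padic_add.
Proof. by move=> x; apply: padic_intP => k /=; rewrite addNr. Qed.

HB.instance Definition _ :=
  GRing.isZmodule.Build padic_int padic_addA padic_addC padic_add0 padic_addN.

Fact padic_mulA : associative padic_mul.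
Proof. by move=> x y z; apply: padic_intP => k /=; rewrite mulrA. Qed.
Fact padic_mulC : commutative padic_mul.
Proof. by move=> x y; apply: padic_intP => k /=; rewrite mulrC. Qed.
Fact padic_mul1 : left_id (padic_nat 1) padic_mul.
Proof. by move=> x; apply: padic_intP => k /=; rewrite mul1r. Qed.
Fact padic_mulDl : left_distributive padic_mul padic_add.
Proof. by move=> x y z; apply: padic_intP => k /=; rewrite mulrDl. Qed.
Fact padic_one_neq0 : padic_nat 1 != 0.
Proof.
apply/eqP => /(congr1 (fun x : padic_int => x 0%N)) /= /eqP.
by rewrite oner_eq0.
Qed.

HB.instance Definition _ := GRing.Zmodule_isComNzRing.Build padic_int
  padic_mulA padic_mulC padic_mul1 padic_mulDl padic_one_neq0.
HB.instance Definition _ := GRing.ComNzRing_hasMulInverse.Build padic_int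
  (@cmulVx padic_int) (@cunitPl padic_int) (@cinv_out padic_int).

Lemma padic_res_le (x : padic_int) k j : (k <= j)%N -> (x j : nat)%:R = x k.
Proof.
move=> /subnKC <-; elim: (j - k)%N => [|i IH]; first by rewrite addn0 natr_Zp.
rewrite addnS -IH -(padic_resP x (k + i)%N) val_Zp_nat ?padic_pow_gt1 //.
by rewrite padic_natr_mod ?leq_addr.
Qed.

Lemma padic_logn (x : padic_int) k j : (k <= j)%N -> x k != 0 ->
  (0 < x j)%N /\ (logn p (x j) <= k)%N.
Proof.
move=> kj; rewrite -(padic_res_le x kj) => xk0.
have x_gt0 : (0 < x j)%N by rewrite lt0n; apply: contra_neq xk0 => ->.
split=> //; rewrite leqNgt -pfactor_dvdn //; apply: contra xk0 => /eqP h.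
by apply/eqP/val_inj; rewrite /= val_Zp_nat ?padic_pow_gt1 // h.
Qed.

Fact padic_integral (x y : padic_int) : x * y = 0 -> (x == 0) || (y == 0).
Proof.
move=> xy0; apply/orP; apply: contrapT => /not_orP[/negP x0 /negP y0].
have nz (z : padic_int) : z != 0 -> exists k, z k != 0.
  move=> z0; apply: contrapT => h; case/eqP: z0; apply: padic_intP => k.
  by apply/eqP; apply: contrapT => /negP zk; apply: h; exists k.
have [k xk] := nz _ x0; have [l yl] := nz _ y0.
have [xj lx] := padic_logn (leq_addr l k) xk.
have [yj ly] := padic_logn (leq_addl k l) yl.
have xy : x (k + l)%N * y (k + l)%N = 0.
  exact: (congr1 (fun z : padic_int => z (k + l)%N) xy0).
have := congr1 (@nat_of_ord _) xy; rewrite padic_valM => /eqP.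
rewrite -/(dvdn _ _) pfactor_dvdn ?muln_gt0 ?xj // lognM //.
by apply/negP; rewrite -leqNgt leq_add.
Qed.

HB.instance Definition _ :=
  GRing.ComUnitRing_isIntegral.Build padic_int padic_integral.

Definition padic : fieldType := {fraction padic_int}.
End PadicInt.

(* F[[t]] as the ring of coefficient sequences with the Cauchy product. *)
Section PowerSeries.
Variable F : fieldType.

Record fps := Fps { fps_coef :> nat -> F }.

Lemma fpsP (f g : fps) : (forall k, f k = g k) -> f = g.
Proof. by case: f g => [f] [g] /= fg; congr Fps; apply: funext. Qed.

HB.instance Definition _ := gen_eqMixin fps.
HB.instance Definition _ := gen_choiceMixin fps.

Definition fps_zero := Fps (fun=> 0).
Definition fps_one := Fps (fun k => (k == 0)%:R).
Definition fps_add (f g : fps) := Fps (fun k => f k + g k).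
Definition fps_opp (f : fps) := Fps (fun k => - f k).
Definition fps_mul (f g : fps) := Fps (fun k => \sum_(i < k.+1) f i * g (k - i)%N).

Fact fps_addA : associative fps_add.
Proof. by move=> f g h; apply: fpsP => k /=; rewrite addrA. Qed.
Fact fps_addC : commutative fps_add.
Proof. by move=> f g; apply: fpsP => k /=; rewrite addrC. Qed.
Fact fps_add0 : left_id fps_zero fps_add.
Proof. by move=> f; apply: fpsP => k /=; rewrite add0r. Qed.
Fact fps_addN : left_inverse fps_zero fps_opp fps_add.
Proof. by move=> f; apply: fpsP => k /=; rewrite addNr. Qed.

HB.instance Definition _ :=
  GRing.isZmodule.Build fps fps_addA fps_addC fps_add0 fps_addN.

Let T m (f : fps) : {poly F} := \poly_(i < m) f i.

Let coefT m f i : (i < m)%N -> (T m f)`_i = f i.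
Proof. by move=> im; rewrite coef_poly im. Qed.

Let coef_mul m f g k : (k < m)%N -> fps_mul f g k = (T m f * T m g)`_k.
Proof.
move=> km; rewrite coefM /=; apply: eq_bigr => i _.
rewrite !coefT //; first by rewrite (leq_ltn_trans (leq_subr _ _)).
by rewrite (leq_trans (ltn_ord i)).
Qed.

Fact fps_mulC : commutative fps_mul.
Proof. by move=> f g; apply: fpsP => k; rewrite !(@coef_mul k.+1) // mulrC. Qed.

Fact fps_mulA : associative fps_mul.
Proof.
move=> f g h; apply: fpsP => k; rewrite !(@coef_mul k.+1) //.
transitivity ((T k.+1 f * (T k.+1 g * T k.+1 h))`_k).
  rewrite !coefM; apply: eq_bigr => i _.
  have ki : (k - i < k.+1)%N by rewrite ltnS leq_subr.
  by rewrite [X in _ * X]coefT // (@coef_mul k.+1).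
rewrite mulrA !coefM; apply: eq_bigr => i _.
by rewrite [X in _ = X * _]coefT // (@coef_mul k.+1).
Qed.

Fact fps_mul1 : left_id fps_one fps_mul.
Proof.
move=> f; apply: fpsP => k; rewrite /= big_ord_recl /= mul1r subn0.
by rewrite big1 ?addr0 // => i _; rewrite mul0r.
Qed.

Fact fps_mulDl : left_distributive fps_mul fps_add.
Proof.
move=> f g h; apply: fpsP => k; rewrite /= -big_split /=.
by apply: eq_bigr => i _; rewrite mulrDl.
Qed.

Fact fps_one_neq0 : fps_one != 0.
Proof.
by apply/eqP => /(congr1 (fun f : fps => f 0%N)) /= /eqP; rewrite oner_eq0.
Qed.

HB.instance Definition _ := GRing.Zmodule_isComNzRing.Build fps
  fps_mulA fps_mulC fps_mul1 fps_mulDl fps_one_neq0.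
HB.instance Definition _ := GRing.ComNzRing_hasMulInverse.Build fps
  (@cmulVx fps) (@cunitPl fps) (@cinv_out fps).

Fact fps_integral (f g : fps) : f * g = 0 -> (f == 0) || (g == 0).
Proof.
move=> fg0; apply/orP; apply: contrapT => /not_orP[/negP f0 /negP g0].
have nz (h : fps) : h != 0 -> exists k, h k != 0.
  move=> h0; apply: contrapT => H; case/eqP: h0; apply: fpsP => k.
  by apply/eqP; apply: contrapT => /negP hk; apply: H; exists k.
case: (ex_minnP (nz _ f0)) => a fa min_a.
case: (ex_minnP (nz _ g0)) => b gb min_b.
have := congr1 (fun z : fps => z (a + b)%N) fg0.
have aP : (a < (a + b).+1)%N by rewrite ltnS leq_addr.
rewrite /= (bigD1 (Ordinal aP)) //= addKn big1 ?addr0.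
  by apply/eqP; rewrite mulf_neq0.
move=> i /eqP ia; case: (ltngtP i a) => [lt_ia|lt_ai|E].
- have -> : f i = 0; last by rewrite mul0r.
  by apply/eqP; apply: contraLR lt_ia => /min_a; rewrite -leqNgt.
- have -> : g (a + b - i)%N = 0; last by rewrite mulr0.
  apply/eqP; apply: contraT => /min_b; rewrite leqNgt => /negP[].
  by rewrite ltn_subLR ?ltn_add2r // -ltnS.
- by case: ia; apply: val_inj.
Qed.

HB.instance Definition _ := GRing.ComUnitRing_isIntegral.Build fps fps_integral.

Definition fps_t : fps := Fps (fun k => (k == 1)%:R).

(* F((t)) *)
Definition laurent : fieldType := {fraction fps}.
End PowerSeries.

Definition padic_integers (p : nat) (p_pr : prime p) : set (padic p_pr) :=
  range (@tofrac (padic_int p_pr)).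

Definition laurent_integers (F : fieldType) : set (laurent F) :=
  range (@tofrac (fps F)).

(* The integral closure of Z_p in a finite extension of Q_p. *)
Definition ext_integers (p : nat) (p_pr : prime p)
    (L : fieldExtType (padic p_pr)) : set L :=
  [set x | integralOver (fun z : padic_int p_pr => (tofrac z)%:A : L) x].

Section NonArchimedean.
(* O is meant to be the ring of integers of L. *)
Variables (L : fieldType) (O : set L).

Definition integer_unit (x : L) : Prop := [/\ x != 0, O x & O x^-1].

(* O is local: its maximal ideal is the set of its non-units. *)
Definition maximal_ideal : set L := [set x | O x /\ ~ integer_unit x].

Definition uniformizer (rho : L) : Prop :=
  maximal_ideal = [set rho * x | x in O].

Definition na_ord (rho y : L) : int :=
  xget 0 [set k : int | integer_unit (y / rho ^ k)].

(* The class of x modulo the maximal ideal, as a subset of L. *)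
Definition residue (x : L) : set L := [set z | maximal_ideal (z - x)].

Definition na_phase (rho y : L) : set L := residue (y / rho ^ na_ord rho y).

Definition na_phase_one (rho y : L) : Prop := na_phase rho y = residue 1.
End NonArchimedean.

Section Archimedean.
Variable L : numFieldType.

Definition arch_phase (y : L) : L := y / `|y|.

Definition arch_phase_one (y : L) : Prop := arch_phase y = 1.
End Archimedean.

(* R is the field of real numbers. *)
Inductive local_field (R : realType) : Type :=
| LReal
| LComplex
| LPadic (p : nat) (p_pr : prime p) (L : fieldExtType (padic p_pr))
| LLaurent (F : finFieldType).

Section LocalField.
Variable R : realType.

Definition local_sort (K : local_field R) : fieldType :=
  match K with
  | LReal => R
  | LComplex => R[i]
  | LPadic p p_pr L => L
  | LLaurent F => laurent F
  end.

Coercion local_sort : local_field >-> GRing.Field.type.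

(* The choice the generalized phase depends on: a uniformizer if K is
   non-Archimedean, nothing otherwise. *)
Definition phase_choice (K : local_field R) : Type :=
  match K with
  | LReal | LComplex => unit
  | LPadic p p_pr L => {rho : L | uniformizer (@ext_integers p p_pr L) rho}
  | LLaurent F =>
      {rho : laurent F | uniformizer (@laurent_integers F) rho}
  end.

Definition local_ord (K : local_field R) : phase_choice K -> K -> R :=
  match K return phase_choice K -> local_sort K -> R with
  | LReal => fun _ y => - ln `|y|
  | LComplex => fun _ y => - ln (complex.Re `|y|)
  | LPadic p p_pr L =>
      fun rho y => (na_ord (@ext_integers p p_pr L) (sval rho) y)%:~R
  | LLaurent F =>
      fun rho y => (na_ord (@laurent_integers F) (sval rho) y)%:~R
  end.

Definition phase_one (K : local_field R) : phase_choice K -> K -> Prop :=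
  match K return phase_choice K -> local_sort K -> Prop with
  | LReal => fun _ y => arch_phase_one y
  | LComplex => fun _ y => arch_phase_one y
  | LPadic p p_pr L =>
      fun rho y => na_phase_one (@ext_integers p p_pr L) (sval rho) y
  | LLaurent F =>
      fun rho y => na_phase_one (@laurent_integers F) (sval rho) y
  end.
End LocalField.

Section Systems.
Variables (K : fieldType) (n : nat).

Definition psystem := 'I_n -> mpoly n K.

Definition nomial_system (m : nat) (G : psystem) : Prop :=
  size (undup (flatten [seq msupp (G i) | i <- enum 'I_n])) = m.

Definition sys_root (G : psystem) (x : 'rV[K]_n) : Prop :=
  forall i, meval (x ord0) (G i) = 0.

Definition sys_jacobian (G : psystem) (x : 'rV[K]_n) : 'M[K]_n :=
  \matrix_(i < n, j < n) meval (x ord0) (mderiv j (G i)).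

Definition nondegenerate_at (G : psystem) (x : 'rV[K]_n) : Prop :=
  \rank (sys_jacobian G x) = n.

Definition nondeg_roots (G : psystem) : set 'rV[K]_n :=
  [set x | sys_root G x /\ nondegenerate_at G x].

(* The variable x_k of the text, 1 <= k <= n (irrelevant for other k). *)
Definition xvar (k : nat) : mpoly n K :=
  if insub k.-1 is Some i then mpolyX K (mnm1 i) else 0.

(* i : 'I_n stands for the equation number k = i + 1. *)
Definition Gsys (eps : K) : psystem := fun i =>
  let k := i.+1 in
  if k == 1 then
    xvar 1 * xvar 2 - (mpolyC n eps + xvar 1 ^+ 2)
  else if (k < n)%N then
    xvar k * xvar k.+1 - (1 + mpolyC n (eps ^+ (2 * k - 3)) * xvar 1 ^+ 2)
  else
    xvar n - (1 + mpolyC n (eps ^+ (2 * n - 3)) * xvar 1 ^+ 2).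
End Systems.
Arguments Gsys {K} n eps _.

Definition map_system (K E : fieldType) (n : nat) (f : K -> E)
    (G : psystem K n) : psystem E n :=
  fun i => map_mpoly f (G i).

(* Main.v *)
(* Put f_1 = eps + u and f_i = 1 + eps^(2i-3) u for 2 <= i <= n, and let A_k be
   the product of the f_i with k <= i <= n and i = k mod 2. A root of the system
   satisfies x_i = A_i(u) / A_(i+1)(u) with u = x_1^2, and u is a root of
   H = A_1^2 - u A_2^2, which has degree at most n + 1. Hence, once n + 1 distinct
   roots of H are found in L, they are simple, they are all the roots of H in any
   extension, and simplicity of u means non-degeneracy of x.

   Over the reals, for 0 < eps <= 1/4, H has sign (-1)^k at eps^(3-2k) for
   0 <= k <= n + 1, so the intermediate value theorem gives n + 1 positive roots.
   Over the complex numbers the roots are these real ones.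

   In the non-Archimedean case put u = eps^(2-2j) w with 0 <= j <= n. Up to a
   constant, H becomes w^j (w - 1) + eps g(w), where g has coefficients in Z[eps],
   and Hensel's lemma gives a root w = 1 modulo the maximal ideal. The f_i(u) are
   then products of powers of eps and elements congruent to 1, so they have
   phase 1. In a finite extension of Q_p, Hensel's lemma is applied in Z_p[eps],
   which is p-adically complete and in which a power of eps is divisible by p. *)
Require Import Defs.
From HB Require Import structures.
From mathcomp Require Import all_boot all_order all_algebra all_field fraction.
From mathcomp Require Import complex.
From mathcomp Require Import boolp classical_sets cardinality reals exp.
From mathcomp Require Import -(notations) mpoly.
From mathcomp Require Import ring lra zify.

Set Implicit Arguments.
Unset Strict Implicit.
Unset Printing Implicit Defensive.

Import Order.TTheory GRing.Theory Num.Theory.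
Local Open Scope classical_set_scope.
Local Open Scope ring_scope.

(** * The eliminant *)

Section AlternatingProducts.
Variable n : nat.

Definition oprod (R : comNzRingType) (f : nat -> R) (k : nat) : R :=
  \prod_(k <= i < n.+1 | odd i == odd k) f i.

Lemma oprod_rec (R : comNzRingType) (f : nat -> R) k : (k <= n)%N ->
  oprod f k = f k * oprod f k.+2.
Proof.
move=> kn; rewrite /oprod big_ltn_cond ?ltnS // eqxx; congr (_ * _).
have [k1n|nk1] := ltnP k.+1 n.+1.
  rewrite big_ltn_cond //= (_ : (~~ odd k == odd k) = false); last by case: odd.
  by apply: eq_bigl => i; rewrite negbK.
by rewrite !big_geq // ltnW.
Qed.

Lemma oprod_out (R : comNzRingType) (f : nat -> R) k : (n < k)%N ->
  oprod f k = 1.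
Proof. by move=> nk; rewrite /oprod big_geq. Qed.

Lemma down_ind2 (P : nat -> Prop) :
  (forall k, (n < k)%N -> P k) ->
  (forall k, (k <= n)%N -> P k.+2 -> P k) -> forall k, P k.
Proof.
move=> P0 PS k; move: {2}(n.+1 - k)%N (leqnn (n.+1 - k)) => m.
elim/ltn_ind: m k => m IH k km; have [kn|/P0//] := leqP k n.
by apply: PS => //; apply: (IH (n.+1 - k.+2)%N); lia.
Qed.

Lemma down_ind (P : nat -> Prop) :
  (forall k, (n < k)%N -> P k) ->
  (forall k, (k <= n)%N -> P k.+1 -> P k) -> forall k, P k.
Proof.
move=> P0 PS k; move: {2}(n.+1 - k)%N (leqnn (n.+1 - k)) => m.
elim/ltn_ind: m k => m IH k km; have [kn|/P0//] := leqP k n.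
by apply: PS => //; apply: (IH (n.+1 - k.+1)%N); lia.
Qed.

(** Each [f i] contributes the pair [tau i * tau i.+1] and the indices step by two, so the pairs
    tile k, ..., n without overlap. The last pair may stick out by [tau n.+1], hence the
    normalisation [tau n.+1 = 1]. *)
Lemma oprod_scale (R : comNzRingType) (f tau phi : nat -> R) k0 :
  tau n.+1 = 1 ->
  (forall i, (k0 <= i <= n)%N -> f i = tau i * tau i.+1 * phi i) ->
  forall k, (k0 <= k)%N ->
    oprod f k = (\prod_(k <= i < n.+1) tau i) * oprod phi k.
Proof.
move=> tau1 fE; apply: down_ind2 => k kn.
  by move=> _; rewrite !oprod_out // big_geq // mulr1.
move=> IH k0k; rewrite oprod_rec // (@oprod_rec _ phi k) // IH; last by lia.
rewrite fE ?k0k // [in RHS]big_ltn ?ltnS //.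
have [k1n|nk1] := ltnP k.+1 n.+1; first by rewrite [in RHS]big_ltn //; ring.
rewrite !big_geq //; last by lia.
by have -> : k = n; [lia | rewrite tau1; ring].
Qed.

End AlternatingProducts.

Section Eliminant.
Variables (K : fieldType) (n : nat).

(* For i = 1 the truncated exponent 2 * i - 3 is 0, so that fac eps 1 is eps + X. *)
Definition fac (eps : K) (i : nat) : {poly K} :=
  (if i == 1%N then eps else 1)%:P + eps ^+ (2 * i - 3) *: 'X.

Definition facval (eps : K) (i : nat) (u : K) : K :=
  (if i == 1%N then eps else 1) + eps ^+ (2 * i - 3) * u.

Definition eliminant (eps : K) : {poly K} :=
  oprod n (fac eps) 1 ^+ 2 - 'X * oprod n (fac eps) 2 ^+ 2.

Lemma horner_fac eps i u : (fac eps i).[u] = facval eps i u.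
Proof. by rewrite /fac !hornerE. Qed.

Lemma horner_oprod_fac eps k u :
  (oprod n (fac eps) k).[u] = oprod n (fun i => facval eps i u) k.
Proof.
by rewrite /oprod horner_prod; apply: eq_bigr => i _; rewrite horner_fac.
Qed.

Lemma horner_eliminant eps u : (eliminant eps).[u] =
  oprod n (fun i => facval eps i u) 1 ^+ 2
  - u * oprod n (fun i => facval eps i u) 2 ^+ 2.
Proof.
by rewrite hornerD hornerN horner_exp hornerM hornerX horner_exp !horner_oprod_fac.
Qed.

(** A_k has at most (n + 2 - k) / 2 factors, each of degree at most 1; doubling the degree avoids
    the halving. *)
Lemma size_oprod_fac eps k : (k <= n.+2)%N ->
  (2 * (size (oprod n (fac eps) k)).-1 <= n.+2 - k)%N.
Proof.
elim/(@down_ind2 n): k => k kn; first by rewrite oprod_out // size_poly1.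
move=> /(_ kn) IH _; rewrite oprod_rec //.
have sf : (size (fac eps k) <= 2)%N.
  apply: (leq_trans (size_polyD _ _)); rewrite geq_max.
  rewrite (leq_trans (size_polyC_leq1 _)) //=.
  by rewrite (leq_trans (size_scale_leq _ _)) // size_polyX.
have := size_polyMleq (fac eps k) (oprod n (fac eps) k.+2).
move: IH sf; set a := size _; set b := size (fac _ _); set c := size _.
by clearbody a b c; lia.
Qed.

Lemma size_eliminant eps : (2 <= n)%N -> (size (eliminant eps) <= n.+2)%N.
Proof.
move=> hn; apply: (leq_trans (size_polyD _ _)); rewrite size_polyN geq_max.
have s1 := @size_oprod_fac eps 1 isT; have s2 := @size_oprod_fac eps 2 isT.
apply/andP; split; rewrite expr2.
  by apply: (leq_trans (size_polyMleq _ _)); move: (size _) s1 => a; lia.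
apply: (leq_trans (size_polyMleq _ _)); rewrite size_polyX add2n /= ltnS.
by apply: (leq_trans (size_polyMleq _ _)); move: (size _) s2 => a; lia.
Qed.

Lemma facval0 eps i : facval eps i 0 = if i == 1%N then eps else 1.
Proof. by rewrite /facval mulr0 addr0. Qed.

(** At u = 0 every f_i with i >= 2 is 1 and f_1 is eps. *)
Lemma eliminant0 eps : (2 <= n)%N -> (eliminant eps).[0] = eps ^+ 2.
Proof.
move=> hn; rewrite horner_eliminant mul0r subr0.
rewrite oprod_rec; last by lia.
rewrite facval0 /=; suff -> : oprod n ((facval eps)^~ 0) 3 = 1 by rewrite mulr1.
rewrite /oprod big_nat_cond big1 // => i /andP[/andP[i3 _] _].
by rewrite facval0; case: eqP i3 => // ->.
Qed.

Lemma eliminant_neq0 eps : (2 <= n)%N -> eps != 0 -> eliminant eps != 0.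
Proof.
move=> hn e0; apply/eqP => H; have := eliminant0 eps hn.
by rewrite H horner0 => /esym/eqP; rewrite expf_eq0 (negPf e0).
Qed.

End Eliminant.

Lemma map_fac (K E : fieldType) (iota : {rmorphism K -> E}) eps i :
  map_poly iota (fac eps i) = fac (iota eps) i.
Proof.
rewrite /fac rmorphD /= map_polyC /= map_polyZ /= map_polyX rmorphXn /=.
by case: eqP => // _; rewrite rmorph1.
Qed.

Lemma map_eliminant (K E : fieldType) (iota : {rmorphism K -> E}) n eps :
  map_poly iota (eliminant n eps) = eliminant n (iota eps).
Proof.
rewrite /eliminant rmorphB rmorphXn rmorphM rmorphXn /= map_polyX /oprod !rmorph_prod.
by congr (_ ^+ 2 - _ * _ ^+ 2); apply: eq_bigr => i _ /=; rewrite map_fac.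
Qed.

Lemma map_facval (K E : fieldType) (iota : {rmorphism K -> E}) eps i u :
  iota (facval eps i u) = facval (iota eps) i (iota u).
Proof. by rewrite -!horner_fac -map_fac horner_map. Qed.

(** * The equations and their differential in coordinates *)

Section System.
Variables (K : fieldType) (n : nat).
Hypothesis hn : (2 <= n)%N.
Implicit Types (x v : 'rV[K]_n) (eps : K).

(* The text's x_k, 1 <= k <= n, extended by [d] to k = n + 1. *)
Definition coord (d : K) x (k : nat) : K :=
  if insub k.-1 is Some i then x ord0 i else d.

Lemma coord_ord d x (i : 'I_n) : coord d x i.+1 = x ord0 i.
Proof. by rewrite /coord /= valK. Qed.

Lemma coord_out d x k : (n < k)%N -> coord d x k = d.
Proof. by case: k => // k nk; rewrite /coord /= insubN // -leqNgt. Qed.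

Lemma meval_xvar x d k : (0 < k <= n)%N ->
  meval (x ord0) (xvar K n k) = coord d x k.
Proof.
case: k => // k kn; rewrite /xvar /coord /=; case: insubP => [i _ ik|].
  by rewrite mevalXU.
by move: kn => /= ->.
Qed.

(** The default x_(n+1) = 1 and the truncated exponent 0 at i = 1 give all n equations the single
    shape x_k x_(k+1) = f_k(x_1^2). *)
Lemma meval_Gsys eps x (i : 'I_n) :
  meval (x ord0) (Gsys n eps i) =
  coord 1 x i.+1 * coord 1 x i.+2 - facval eps i.+1 (coord 1 x 1 ^+ 2).
Proof.
have n1 : (0 < 1 <= n)%N by lia.
rewrite /Gsys /facval eqSS; case: eqP => [->|i0].
  by rewrite mevalB mevalD !mevalM mevalC !(@meval_xvar x 1) ?mul1r.
have [lin|nli] := ltnP i.+1 n; rewrite mevalB mevalD meval1.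
  rewrite !mevalM mevalC !(@meval_xvar x 1) //; lia.
have -> : i.+2 = n.+1 by have := ltn_ord i; lia.
rewrite (coord_out _ _ (ltnSn n)) mulr1 !mevalM mevalC !(@meval_xvar x 1) //; last by lia.
by have -> : i.+1 = n by have := ltn_ord i; lia.
Qed.

Lemma sys_rootE eps x : sys_root (Gsys n eps) x <->
  forall k, (0 < k <= n)%N ->
    coord 1 x k * coord 1 x k.+1 = facval eps k (coord 1 x 1 ^+ 2).
Proof.
split=> [Gx [//|k] kn|Gx i].
  apply/eqP; rewrite -subr_eq0 -(meval_Gsys eps x (Ordinal kn)).
  by rewrite Gx.
by rewrite meval_Gsys Gx ?subrr // ltn_ord.
Qed.

(** The differential of p at x applied to v. Vectors on which it kills every g_i form the kernel of
    the Jacobian, and the product rule computes it without matrix entries. *)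
Definition pderdir x v (p : mpoly n K) : K :=
  \sum_(j < n) v ord0 j * meval (x ord0) (mderiv j p).

Lemma pderdirB x v p q : pderdir x v (p - q) = pderdir x v p - pderdir x v q.
Proof.
by rewrite -sumrB; apply: eq_bigr => j _; rewrite mderivB mevalB mulrBr.
Qed.

Lemma pderdirD x v p q : pderdir x v (p + q) = pderdir x v p + pderdir x v q.
Proof.
by rewrite -big_split; apply: eq_bigr => j _; rewrite mderivD mevalD mulrDr.
Qed.

Lemma pderdirM x v p q : pderdir x v (p * q) =
  pderdir x v p * meval (x ord0) q + meval (x ord0) p * pderdir x v q.
Proof.
rewrite mulr_suml mulr_sumr -big_split; apply: eq_bigr => j _ /=.
by rewrite mderivM mevalD !mevalM; ring.
Qed.

Lemma pderdirC x v c : pderdir x v (mpolyC n c) = 0.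
Proof. by apply: big1 => j _; rewrite mderivC meval0 mulr0. Qed.

Lemma pderdir_xvar x v d k : (0 < k <= n)%N ->
  pderdir x v (xvar K n k) = coord d v k.
Proof.
case: k => // k kn; rewrite /xvar /coord /=; case: insubP => [i _ ik|].
  rewrite /pderdir (bigD1 i) //= big1 ?addr0 => [|j ji].
    rewrite mderivX mnm1E eqxx scale1r.
    rewrite (_ : mnm_sub _ _ = mnm0) ?mpolyX0 ?meval1 ?mulr1 //.
    by apply/mnmP => l; rewrite mnmBE subnn mnm0E.
  by rewrite mderivX mnm1E eq_sym (negPf ji) scale0r meval0 mulr0.
by move: kn => /= ->.
Qed.

(** The direction v is extended by 0 because the added coordinate x_(n+1) = 1 is constant. *)
Lemma pderdir_Gsys eps x v (i : 'I_n) :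
  pderdir x v (Gsys n eps i) =
  coord 0 v i.+1 * coord 1 x i.+2 + coord 1 x i.+1 * coord 0 v i.+2
  - eps ^+ (2 * i.+1 - 3) * (2 * coord 1 x 1 * coord 0 v 1).
Proof.
have n1 : (0 < 1 <= n)%N by lia.
rewrite /Gsys eqSS; case: eqP => [->|i0].
  rewrite pderdirB pderdirD !pderdirM pderdirC.
  rewrite !(@meval_xvar x 1) // !(@pderdir_xvar x v 0) //=; ring.
have [lin|nli] := ltnP i.+1 n; rewrite pderdirB pderdirD.
  rewrite -[1 in X in _ - X]mpolyC1 !pderdirM !pderdirC mevalC.
  rewrite !(@meval_xvar x 1) ?(@pderdir_xvar x v 0) //; try lia.
  by ring.
have -> : i.+2 = n.+1 by have := ltn_ord i; lia.
rewrite !(coord_out _ _ (ltnSn n)) mulr1 mulr0 addr0.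
rewrite -[1 in X in _ - X]mpolyC1 !pderdirM !pderdirC mevalC.
rewrite !(@meval_xvar x 1) ?(@pderdir_xvar x v 0) //; try lia.
have -> : i.+1 = n by have := ltn_ord i; lia.
by ring.
Qed.

End System.

(** * Correspondence between roots of the system and roots of the eliminant *)

Section Roots.
Variables (K : fieldType) (n : nat) (eps : K).
Hypotheses (hn : (2 <= n)%N) (eps0 : eps != 0) (eps2 : eps ^+ 2 != 1).
Local Notation A u := (oprod n (fun i => facval eps i u)).

Section RootOfSystem.
Variable x : 'rV[K]_n.
Hypothesis Gx : sys_root (Gsys n eps) x.
Local Notation u := (coord 1 x 1 ^+ 2).

Lemma coord_mul k : (0 < k <= n)%N ->
  coord 1 x k * coord 1 x k.+1 = facval eps k u.
Proof. exact: (sys_rootE hn eps x).1. Qed.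

(** If x_1 = 0 then u = 0, and f_1 = eps contradicts the first equation. If x_k = 0 with 2 <= k <=
    n, then f_(k-1) and f_k both vanish at u; but f_2 - eps f_1 and, for k >= 3, f_k - eps^2 f_(k-1)
    both equal 1 - eps^2, which is non-zero. *)
Lemma coord_neq0 k : (0 < k)%N -> coord 1 x k != 0.
Proof.
have eps2' : 1 - eps ^+ 2 != 0 by rewrite subr_eq0 eq_sym.
case: k => // -[_|k _].
  have E := @coord_mul 1 (ltnW hn).
  apply: contraNneq eps0 => x0.
  by move: E; rewrite x0 mul0r expr0n /= facval0 /= => ->.
have [kn|nk] := leqP k.+2 n; last by rewrite coord_out ?oner_eq0.
have Ek := @coord_mul k.+1 (ltnW kn).
have Ek1 := @coord_mul k.+2 kn.
apply: contraNneq eps2' => xk; move: Ek Ek1; rewrite xk mul0r mulr0.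
rewrite /facval; case: k {xk kn} => [|k] /= E E1.
  rewrite (_ : 1 - eps ^+ 2 = 1 + eps ^+ (2 * 2 - 3) * u
                  - eps * (eps + eps ^+ (2 * 1 - 3) * u)); last by ring.
  by rewrite -E -E1 mulr0 subrr.
rewrite (_ : 1 - eps ^+ 2 = 1 + eps ^+ (2 * k.+3 - 3) * u
                - eps ^+ 2 * (1 + eps ^+ (2 * k.+2 - 3) * u)).
  by rewrite -E -E1 mulr0 subrr.
have -> : (2 * k.+3 - 3 = 2 + (2 * k.+2 - 3))%N by lia.
by rewrite exprD; ring.
Qed.

(** Downward induction: f_k A_(k+2) = x_k x_(k+1) A_(k+2) = x_k A_(k+1). *)
Lemma oprod_coord k : (0 < k)%N -> A u k = coord 1 x k * A u k.+1.
Proof.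
elim/(@down_ind n): k => k kn.
  by move=> _; rewrite (coord_out _ _ kn) !oprod_out ?mulr1 // ltnW.
move=> IH k0; rewrite oprod_rec // IH // mulrA coord_mul //.
by rewrite k0.
Qed.

Lemma oprod_coord_neq0 k : (0 < k)%N -> A u k != 0.
Proof.
elim/(@down_ind n): k => k kn; first by rewrite oprod_out ?oner_eq0.
by move=> IH k0; rewrite oprod_coord // mulf_neq0 ?coord_neq0 ?IH.
Qed.

Lemma coordE k : (0 < k)%N -> coord 1 x k = A u k / A u k.+1.
Proof. by move=> k0; rewrite oprod_coord // mulfK ?oprod_coord_neq0. Qed.

Lemma root_eliminant : root (eliminant n eps) u.
Proof.
rewrite /root horner_eliminant oprod_coord //.
by rewrite exprMn subrr.
Qed.

Local Notation B := (oprod n (fac eps)).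

(* The derivative of [oprod_coord] along v: w is the variation of u = x_1^2. *)
Lemma deriv_oprod_coord (v : 'rV[K]_n) :
  (forall i, pderdir x v (Gsys n eps i) = 0) ->
  forall k, (0 < k)%N ->
  let w := 2 * coord 1 x 1 * coord 0 v 1 in
  (B k)^`().[u] * w = coord 0 v k * (B k.+1).[u]
                      + coord 1 x k * (B k.+1)^`().[u] * w.
Proof.
move=> Gv; elim/(@down_ind n) => k kn.
  move=> _ /=; rewrite !(coord_out _ _ kn) !oprod_out ?derivC ?horner0 // 1?ltnW //.
  by rewrite !mul0r mulr0 mul0r addr0.
move=> IH k0 w; have {}IH := IH isT.
case: k kn k0 IH => // k kn _ IH.
have := Gv (Ordinal kn); rewrite pderdir_Gsys // -/w => /eqP /=.
rewrite subr_eq0 => /eqP Gk.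
have Ek := @coord_mul k.+1 kn.
have Bu l : (B l).[u] = A u l by rewrite horner_oprod_fac.
rewrite oprod_rec // derivM hornerD !hornerM.
have -> : (fac eps k.+1)^`().[u] = eps ^+ (2 * k.+1 - 3).
  by rewrite /fac derivD derivC derivZ derivX !hornerE.
rewrite horner_fac -Ek !mulrDl mulrAC -Gk.
have := IH; rewrite /= -/w => {}IH.
have -> : (B k.+2).[u] = coord 1 x k.+2 * (B k.+3).[u].
  by rewrite !Bu oprod_coord.
by rewrite -[coord 1 x k.+1 * _ * w]mulrA IH; ring.
Qed.

(** Let v be a kernel vector of the Jacobian. The differentiated relation at k = 1 gives v_1 H'(u) =
    0, so v_1 = 0 at a simple root. The variation of u is then 0, and the same relation at k reads
    v_k A_(k+1) = 0. *)
Lemma nondegenerate_simple :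
  ~~ root (eliminant n eps)^`() u -> nondegenerate_at (Gsys n eps) x.
Proof.
move=> Hu; rewrite /nondegenerate_at -mxrank_tr; apply/eqP/inj_row_free => v vJ.
have Gv i : pderdir x v (Gsys n eps i) = 0.
  have := congr1 (fun M : 'rV_n => M ord0 i) vJ; rewrite !mxE => E.
  by rewrite -[RHS]E; apply: eq_bigr => j _; rewrite !mxE.
have D := deriv_oprod_coord Gv.
have v1 : coord 0 v 1 = 0.
  apply/eqP; have := D 1%N isT; rewrite /= => D1.
  have E1 : (oprod n (fac eps) 1).[u] = coord 1 x 1 * (oprod n (fac eps) 2).[u].
    by rewrite !horner_oprod_fac oprod_coord.
  apply: contraNT Hu => v1; rewrite /root /eliminant !expr2 derivB !derivM derivX.
  rewrite hornerD hornerN !(hornerD, hornerM) hornerX hornerC.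
  move: D1 v1; rewrite !E1 -!expr2.
  move: (coord 1 x 1) (coord 0 v 1) => a b.
  move: _.[_] _^`().[_] _^`().[_] => A2 A2' A1' D1 b0.
  apply/eqP/(mulIf b0); rewrite mul0r.
  (* The left side is v_1 H'(u) with A_1 replaced by x_1 A_2; the bracket vanishes by [D1]. *)
  rewrite [LHS](_ : _ = A2 * (A1' * (2 * a * b) - (b * A2 + a * A2' * (2 * a * b)))).
    by rewrite D1 subrr mulr0.
  by ring.
have xk k : (0 < k)%N -> coord 0 v k = 0.
  move=> k0; have := D k k0; rewrite /= v1 !mulr0 addr0 => /esym/eqP.
  rewrite mulf_eq0 horner_oprod_fac (negPf (oprod_coord_neq0 _)) // orbF.
  by move/eqP.
by apply/rowP => i; rewrite mxE -(coord_ord 0) xk.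
Qed.

End RootOfSystem.

Definition sol (u : K) : 'rV[K]_n := \row_i (A u i.+1 / A u i.+2).

Lemma coord_sol u k : (0 < k)%N -> coord 1 (sol u) k = A u k / A u k.+1.
Proof.
case: k => // k _; have [kn|nk] := ltnP k n.
  by rewrite (coord_ord 1 (sol u) (Ordinal kn)) mxE.
by rewrite coord_out // !oprod_out ?divr1 // ltnW.
Qed.

Lemma oprod_facval_neq0 u k : (forall i, (0 < i <= n)%N -> facval eps i u != 0) ->
  (0 < k)%N -> A u k != 0.
Proof.
move=> fu; elim/(@down_ind2 n): k => k kn; first by rewrite oprod_out ?oner_eq0.
by move=> IH k0; rewrite oprod_rec // mulf_neq0 ?IH ?fu ?k0.
Qed.

Lemma coord_sol1 u : (forall i, (0 < i <= n)%N -> facval eps i u != 0) ->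
  root (eliminant n eps) u -> coord 1 (sol u) 1 ^+ 2 = u.
Proof.
move=> fu; rewrite /root horner_eliminant subr_eq0.
move=> /eqP E; rewrite coord_sol // expr_div_n E mulfK //.
by rewrite expf_neq0 // oprod_facval_neq0.
Qed.

(** The quotients telescope: x_k x_(k+1) = A_k / A_(k+2) = f_k. The equation H(u) = 0 is what makes
    x_1^2 equal to u. *)
Lemma sol_root u : (forall i, (0 < i <= n)%N -> facval eps i u != 0) ->
  root (eliminant n eps) u -> sys_root (Gsys n eps) (sol u).
Proof.
move=> fu Hu; apply/sys_rootE => // k /andP[k0 kn].
rewrite coord_sol1 // !coord_sol // mulrA mulfVK; last exact: oprod_facval_neq0.
by rewrite oprod_rec // mulfK // oprod_facval_neq0.
Qed.

Lemma sys_root_sol x : sys_root (Gsys n eps) x -> x = sol (coord 1 x 1 ^+ 2).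
Proof.
by move=> Gx; apply/rowP => i; rewrite mxE -(coord_ord 1) coordE.
Qed.

End Roots.

(** * Exponent vectors, and systems whose eliminant splits *)

Section Support.
Variables (K : fieldType) (n : nat) (eps : K).
Hypothesis hn : (2 <= n)%N.

(** The exponent of x_(i+1) x_(i+2) for a 0-based i. At i = n - 1 the second indicator never fires,
    which leaves x_n, the leading monomial of the last equation. *)
Definition mnm_lead (i : nat) : multinom n :=
  Multinom [tuple ((j : nat) == i) + ((j : nat) == i.+1) | j < n]%N.

Definition mnm_sqr : multinom n :=
  Multinom [tuple (((j : nat) == 0) .*2)%N | j < n].

Lemma mnm_leadE i (j : 'I_n) :
  mnm_lead i j = (((j : nat) == i) + ((j : nat) == i.+1))%N.
Proof. exact: mnmE. Qed.

Lemma mnm_sqrE (j : 'I_n) : mnm_sqr j = (((j : nat) == 0) .*2)%N.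
Proof. exact: mnmE. Qed.

Lemma mnm_lead_inj : injective (fun i : 'I_n => mnm_lead i).
Proof.
move=> i j E; apply: val_inj => /=.
have /= := congr1 (fun m : multinom n => m i) E.
have /= := congr1 (fun m : multinom n => m j) E.
rewrite !mnm_leadE; lia.
Qed.

Lemma mnm_lead_neq0 (i : 'I_n) : mnm_lead i != mnm0.
Proof.
apply/eqP => /(congr1 (fun m : multinom n => m i)).
by rewrite mnm_leadE mnm0E eqxx.
Qed.

Lemma mnm_lead_neq_sqr (i : 'I_n) : mnm_lead i != mnm_sqr.
Proof.
apply/eqP => /(congr1 (fun m : multinom n => m i)).
by rewrite mnm_leadE mnm_sqrE; lia.
Qed.

Lemma mnm_sqr_neq0 : mnm_sqr != mnm0.
Proof.
apply/eqP => /(congr1 (fun m : multinom n => m (Ordinal (ltnW hn)))).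
by rewrite mnm_sqrE mnm0E.
Qed.

Lemma xvarE (i : 'I_n) : xvar K n i.+1 = mpolyX K (mnm1 i).
Proof. by rewrite /xvar /= valK. Qed.

Lemma Gsys_monomials (i : 'I_n) : Gsys n eps i =
  mpolyX K (mnm_lead i)
  - (mpolyC n (if i == 0 :> nat then eps else 1)
     + mpolyC n (eps ^+ (2 * i.+1 - 3)) * mpolyX K mnm_sqr).
Proof.
have sqrE : xvar K n 1 ^+ 2 = mpolyX K mnm_sqr.
  rewrite (xvarE (Ordinal (ltnW hn))) expr2 -mpolyXD; congr (mpolyX K _).
  by apply/mnmP => j; rewrite mnm_sqrE mnmDE mnm1E -val_eqE /= eq_sym addnn.
have leadE : (i.+1 < n)%N -> xvar K n i.+1 * xvar K n i.+2 = mpolyX K (mnm_lead i).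
  move=> lin; rewrite xvarE (xvarE (Ordinal lin)) -mpolyXD; congr (mpolyX K _).
  apply/mnmP => j; rewrite mnm_leadE mnmDE !mnm1E -!val_eqE /=.
  by rewrite eq_sym [in X in (_ + X)%N]eq_sym.
rewrite /Gsys eqSS sqrE; case: eqP => [i0|i0].
  rewrite -leadE; last by rewrite i0.
  by rewrite i0 mpolyC1 mul1r.
have [lin|nli] := ltnP i.+1 n; first by rewrite leadE // mpolyC1.
have En : i.+1 = n by have := ltn_ord i; lia.
rewrite mpolyC1 En -[X in xvar K n X]En xvarE; congr (mpolyX K _ - _).
apply/mnmP => j; rewrite mnm_leadE mnm1E -val_eqE /= eq_sym.
have -> : ((j : nat) == i.+1) = false by have := ltn_ord j; lia.
by rewrite addn0.
Qed.

Hypothesis eps0 : eps != 0.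

Lemma msupp_Gsys (i : 'I_n) :
  msupp (Gsys n eps i) =i [:: mnm_lead i; mnm0; mnm_sqr].
Proof.
move=> m; rewrite mcoeff_msupp Gsys_monomials mcoeffB mcoeffD mcoeffX.
rewrite mcoeffCM mcoeffX mcoeffC !inE.
have [->|ml] := eqVneq m (mnm_lead i).
  rewrite (negPf (mnm_lead_neq0 i)) [mnm_sqr == _]eq_sym (negPf (mnm_lead_neq_sqr i)).
  by rewrite !mulr0 addr0 subr0 oner_eq0.
rewrite sub0r oppr_eq0 /=.
have [->|m0] /= := eqVneq m mnm0.
  rewrite (negPf mnm_sqr_neq0) mulr1 mulr0 addr0.
  by case: (i == 0 :> nat); rewrite ?oner_eq0 ?eps0.
rewrite mulr0 add0r [mnm_sqr == _]eq_sym; case: (m == mnm_sqr); last by rewrite mulr0 eqxx.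
by rewrite mulr1 expf_neq0.
Qed.

(** The exponents are those of 1, of x_1^2, and of the n pairwise distinct leading monomials. *)
Lemma nomial_Gsys : nomial_system (n + 2) (Gsys n eps).
Proof.
rewrite /nomial_system.
pose l := mnm0 :: mnm_sqr :: [seq mnm_lead (i : 'I_n) | i <- enum 'I_n].
have -> : (n + 2)%N = size l by rewrite /= size_map size_enum_ord addn2.
apply/perm_size/uniq_perm; first exact: undup_uniq.
  rewrite /= inE negb_or eq_sym mnm_sqr_neq0 /=.
  rewrite map_inj_uniq ?enum_uniq ?andbT; last exact: mnm_lead_inj.
  apply/andP; split; apply/mapP => -[i _ E].
    by have := mnm_lead_neq0 i; rewrite -E eqxx.
  by have := mnm_lead_neq_sqr i; rewrite -E eqxx.
move=> m; rewrite mem_undup; apply/flatten_mapP/idP => [[i _]|].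
  rewrite msupp_Gsys !inE => /or3P[] /eqP->; rewrite ?eqxx ?orbT //.
  by apply/orP; right; apply/orP; right; apply: map_f; rewrite mem_enum.
pose o := Ordinal (ltnW hn).
rewrite !inE => /or3P[/eqP->|/eqP->|/mapP[i _ ->]].
- by exists o; rewrite ?mem_enum // msupp_Gsys !inE eqxx orbT.
- by exists o; rewrite ?mem_enum // msupp_Gsys !inE eqxx !orbT.
- by exists i; rewrite ?mem_enum // msupp_Gsys !inE eqxx.
Qed.

End Support.

Lemma map_Gsys (K E : fieldType) (f : {rmorphism K -> E}) n (eps : K) :
  (2 <= n)%N -> map_system f (Gsys n eps) = Gsys n (f eps).
Proof.
move=> hn; apply/funext => i; rewrite /map_system !Gsys_monomials //.
rewrite rmorphB rmorphD rmorphM /= !map_mpolyX !map_mpolyC -(rmorphXn f) /=.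
by case: eqP => // _; rewrite rmorph1.
Qed.

Lemma sol_map (K E : fieldType) (f : {rmorphism K -> E}) n eps u :
  sol n (f eps) (f u) = map_mx f (sol n eps u).
Proof.
have oE k : oprod n ((facval (f eps))^~ (f u)) k
            = f (oprod n ((facval eps)^~ u) k).
  by rewrite /oprod rmorph_prod; apply: eq_bigr => i _; rewrite map_facval.
by apply/rowP => i; rewrite !mxE !oE fmorph_div.
Qed.

(** * From n + 1 roots of the eliminant to all roots of the system *)

Section RootConfiguration.
Variables (K : fieldType) (n : nat) (eps : K).
Hypotheses (hn : (2 <= n)%N) (eps0 : eps != 0) (eps2 : eps ^+ 2 != 1).

(** [Ph] abstracts what is wanted of the coordinates: positivity in the Archimedean cases, phase one
    in the others. *)
Definition mult_subgroup (Ph : K -> Prop) : Prop :=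
  [/\ Ph 1, ~ Ph 0, forall x y, Ph x -> Ph y -> Ph (x * y)
    & forall x, Ph x -> Ph x^-1].

(** The interface between the two kinds of fields: the real and Hensel arguments produce such a
    family, and all claims about roots of the system follow from it. *)
Definition root_config (Ph : K -> Prop) (u : nat -> K) : Prop :=
  [/\ forall j k, (j <= n)%N -> (k <= n)%N -> u j = u k -> j = k,
      forall k, (k <= n)%N -> root (eliminant n eps) (u k)
    & forall k i, (k <= n)%N -> (0 < i <= n)%N -> Ph (facval eps i (u k))].

Variables (Ph : K -> Prop) (u : nat -> K).
Hypotheses (PhG : mult_subgroup Ph) (uC : root_config Ph u).

Lemma mult_subgroup_neq0 x : Ph x -> x != 0.
Proof. by case: PhG => _ Ph0 _ _ Px; apply/eqP => x0; apply: Ph0; rewrite -x0. Qed.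

Lemma sol_config k j : (k <= n)%N -> Ph (sol n eps (u k) ord0 j).
Proof.
case: uC => _ _ uP kn; case: PhG => P1 P0 PM PV; rewrite mxE.
have PA l : (0 < l)%N -> Ph (oprod n ((facval eps)^~ (u k)) l).
  elim/(@down_ind2 n): l => l ln; first by rewrite oprod_out.
  by move=> IH l0; rewrite oprod_rec //; apply: PM; [apply: uP; rewrite ?l0 | exact: IH].
by apply: PM; [exact: PA | apply: PV; exact: PA].
Qed.

Lemma facval_config k i : (k <= n)%N -> (0 < i <= n)%N ->
  facval eps i (u k) != 0.
Proof. by case: uC => _ _ uP kn il; apply/mult_subgroup_neq0/uP. Qed.

(** The degree is at most n + 1, so n + 1 distinct roots give a full factorisation into distinct
    linear factors over K. It is transported along f, and stays separable because f is injective. *)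
Lemma eliminant_config (E : fieldType) (f : {rmorphism K -> E}) z :
  root (eliminant n (f eps)) z ->
  (exists2 k, (k <= n)%N & z = f (u k))
  /\ ~~ root (eliminant n (f eps))^`() z.
Proof.
case: uC => u_inj u_root _; pose rs := [seq u k | k <- iota 0 n.+1].
have rs_uniq : uniq rs.
  rewrite map_inj_in_uniq ?iota_uniq // => j k; rewrite !mem_iota !add0n.
  by move=> /andP[_ ?] /andP[_ ?]; apply: u_inj.
have rs_root : all (root (eliminant n eps)) rs.
  by apply/allP => _ /mapP[k + ->]; rewrite mem_iota add0n => /u_root.
have H0 := eliminant_neq0 hn eps0.
have rs_size : size (eliminant n eps) = (size rs).+1.
  apply/eqP; rewrite eqn_leq max_poly_roots // andbT.
  by rewrite size_map size_iota size_eliminant.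
have := all_roots_prod_XsubC rs_size rs_root; rewrite uniq_rootsE => /(_ rs_uniq) HE.
have fH : eliminant n (f eps) =
    f (lead_coef (eliminant n eps)) *: \prod_(z <- map f rs) ('X - z%:P).
  rewrite -map_eliminant {1}HE map_polyZ rmorph_prod big_map /=.
  by congr (_ *: _); apply: eq_bigr => y _; rewrite rmorphB /= map_polyX map_polyC.
have c0 : f (lead_coef (eliminant n eps)) != 0 by rewrite fmorph_eq0 lead_coef_eq0.
rewrite fH rootZ // derivZ => Hz; split.
  move: Hz; rewrite root_prod_XsubC => /mapP[_ /mapP[k kn ->] ->].
  by exists k => //; move: kn; rewrite mem_iota add0n.
rewrite rootZ //; apply: (coprimep_root _ Hz).
suff : separable_poly (\prod_(z <- map f rs) ('X - z%:P)) by rewrite unlock.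
by rewrite separable_prod_XsubC map_inj_uniq //; apply: fmorph_inj.
Qed.

Lemma config_all_roots (E : fieldType) (f : {rmorphism K -> E}) (x : 'rV[E]_n) :
  sys_root (map_system f (Gsys n eps)) x ->
  nondegenerate_at (map_system f (Gsys n eps)) x
  /\ exists2 k, (k <= n)%N & x = map_mx f (sol n eps (u k)).
Proof.
rewrite map_Gsys // => Gx.
have feps0 : f eps != 0 by rewrite fmorph_eq0.
have feps2 : f eps ^+ 2 != 1 by rewrite -rmorphXn fmorph_eq1.
have [[k kn uk] Hz] := eliminant_config (root_eliminant hn Gx).
split; first exact: nondegenerate_simple.
by exists k => //; rewrite -sol_map -uk; apply: sys_root_sol.
Qed.

(** [P] selects the roots that are counted, while the stronger [Ph] is obtained for all of them. The
    general statement is used with E = K. *)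
Lemma card_config (P : K -> Prop) : (forall x, Ph x -> P x) ->
  let S := nondeg_roots (Gsys n eps)
             `&` [set x : 'rV[K]_n | forall j : 'I_n, P (x ord0 j)] in
  (S #= `I_n.+1)%card /\ forall x, S x -> forall j : 'I_n, Ph (x ord0 j).
Proof.
move=> PhP S; have [u_inj u_root _] := uC.
have SE : S = [set sol n eps (u k) | k in `I_n.+1].
  apply/seteqP; split=> [x [[Gx _] _]|_ [k kn <-]].
    have id_sys : map_system idfun (Gsys n eps) = Gsys n eps by rewrite map_Gsys.
    have := @config_all_roots K idfun x; rewrite id_sys => /(_ Gx)[_ [k kn ->]].
    by exists k => //; apply/rowP => j; rewrite [RHS]mxE.
  have id_sys : map_system idfun (Gsys n eps) = Gsys n eps by rewrite map_Gsys.
  have Gk : sys_root (Gsys n eps) (sol n eps (u k)).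
    by apply: sol_root; rewrite ?u_root // => i il; apply: facval_config.
  have := @config_all_roots K idfun (sol n eps (u k)).
  rewrite id_sys => /(_ Gk)[ndeg _]; split; first by split.
  by move=> j; apply/PhP/sol_config.
split; last by rewrite SE => _ [k kn <-] j; apply: sol_config.
(* Distinct u_k give distinct roots, as u_k is recovered as the square of the first coordinate. *)
rewrite SE; apply: inj_card_eq => j k; rewrite !inE => jn kn /(congr1 (fun x => coord 1 x 1 ^+ 2)).
rewrite !coord_sol1 ?u_root //; first exact: u_inj.
- by move=> i; apply: facval_config.
- by move=> i; apply: facval_config.
Qed.

End RootConfiguration.

(** * Real roots *)

Section AlternatingSequence.
Variables (R : realFieldType) (n k : nat) (eps : R) (x : nat -> R).
Hypotheses (eps0 : 0 < eps) (eps4 : 4 * eps <= 1).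
Hypotheses (hn : (2 <= n)%N) (kn : (k <= n.+1)%N).
Hypothesis x0 : forall i, 0 < x i.
Hypothesis xM : forall i, (0 < i <= n)%N ->
  x i * x i.+1 = 1 + eps ^+ (2 * i) / eps ^+ (2 * k).
Hypothesis x1 : forall i, (n < i)%N -> x i = 1.

Let eps_lt1 : eps < 1. Proof. by move: eps0 eps4 => *; lra. Qed.

(** Downward induction: x_(i+1) <= 1 + eps^(2(i+1-k)) < 1 + eps^(2(i-k)) = x_i x_(i+1) forces x_i >
    1, and x_(i+1) >= 1 bounds x_i by the product. *)
Lemma alt_above i : (k < i)%N ->
  [/\ 1 <= x i, x i <= 1 + eps ^+ (2 * (i - k)) & (i <= n)%N -> 1 < x i].
Proof.
elim/(@down_ind n): i => i ni.
  move=> ki; rewrite x1 // lexx; split=> //; last by rewrite leqNgt ni.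
  by rewrite lerDl exprn_ge0 // ltW.
move=> IH ki; have [le1 le2 _] := IH (ltnW ki).
have /xM : (0 < i <= n)%N by lia.
have -> : (2 * i = 2 * (i - k) + 2 * k)%N by lia.
rewrite exprD mulfK ?expf_neq0 ?(gt_eqF eps0) // => E.
have lt_e : eps ^+ (2 * (i.+1 - k)) < eps ^+ (2 * (i - k)).
  have -> : (2 * (i.+1 - k) = 2 * (i - k) + 2)%N by lia.
  rewrite exprD gtr_pMr ?exprn_gt0 //.
  by rewrite exprn_ilt1 // ltW.
have xi := x0 i; have xi1 := x0 i.+1.
have lt1 : 1 < x i.
  rewrite ltNge; apply/negP => xle.
  have : x i * x i.+1 <= 1 * x i.+1 by rewrite ler_wpM2r // ltW.
  by rewrite E mul1r => ?; lra.
split; [exact: ltW | | by []].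
rewrite -E -[leLHS]mulr1 ler_wpM2l // ltW //.
Qed.

(** Below k the coordinates are read downwards; the power of eps is chosen so that the terms of even
    index stay bounded by 2. *)
Let y m := eps ^+ m * x (k - m).

(** For k <= n, x_k x_(k+1) = 2 with x_(k+1) >= 1. Equality x_k = 2 occurs at k = n, where x_(n+1) =
    1. *)
Lemma alt_base : (0 < k)%N -> y 0 <= 2 /\ (k != n -> y 0 < 2).
Proof.
move=> k0; rewrite /y expr0 mul1r subn0; have [lekn|ltnk] := leqP k n; last first.
  by rewrite (x1 ltnk) ler1n ltr1n.
have /xM : (0 < k <= n)%N by lia.
rewrite divff ?expf_neq0 ?(gt_eqF eps0) // => E.
have [le1 _ lt1] := alt_above (ltnSn k).
have xk := x0 k; split=> [|kNn]; first by nra.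
have {}lt1 : 1 < x k.+1 by apply: lt1; lia.
by nra.
Qed.

Lemma alt_step m : (m.+1 < k)%N -> eps * (y m.+1 * y m) = 1 + eps ^+ (2 * m.+1).
Proof.
move=> mk; rewrite /y; have -> : (k - m = (k - m.+1).+1)%N by lia.
rewrite (_ : eps * _ = eps ^+ (2 * m.+1) * (x (k - m.+1) * x (k - m.+1).+1)); last first.
  have -> : (2 * m.+1 = m.+1 + m + 1)%N by lia.
  by rewrite !exprD expr1; ring.
rewrite xM; last by lia.
have -> : (2 * k = 2 * (k - m.+1) + 2 * m.+1)%N by lia.
have a0 : eps ^+ (2 * m.+1) != 0 by rewrite expf_neq0 ?(gt_eqF eps0).
have b0 : eps ^+ (2 * (k - m.+1)) != 0 by rewrite expf_neq0 ?(gt_eqF eps0).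
rewrite exprD; field.
by rewrite a0 b0.
Qed.

Let y_gt0 m : 0 < y m. Proof. by rewrite mulr_gt0 ?exprn_gt0. Qed.

(** Two consecutive recurrences give y_(m+2) / y_m = (1 + eps^(2m+4)) / (1 + eps^(2m+2)) < 1, so the
    even terms decrease strictly. *)
Lemma alt_even m : (2 * m < k)%N ->
  y (2 * m) <= 2 /\ ((0 < m)%N || (k != n) -> y (2 * m) < 2).
Proof.
elim: m => [|m IH] mk; first by rewrite muln0; apply: alt_base; lia.
have [|le2 _] := IH; first by lia.
suff lt : y (2 * m.+1) < y (2 * m) by split=> [|_]; lra.
have -> : (2 * m.+1 = (2 * m).+2)%N by lia.
have E1 := @alt_step (2 * m).+1 ltac:(lia).
have E0 := @alt_step (2 * m) ltac:(lia).
have c0 : 0 < eps * y (2 * m).+1 by rewrite mulr_gt0.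
rewrite -(ltr_pM2l c0).
rewrite [ltLHS](_ : _ = eps * (y (2 * m).+2 * y (2 * m).+1)); last by ring.
rewrite [ltRHS](_ : _ = eps * (y (2 * m).+1 * y (2 * m))); last by ring.
rewrite E1 E0 ltrD2l.
have -> : (2 * (2 * m).+2 = 2 * (2 * m).+1 + 2)%N by lia.
by rewrite exprD gtr_pMr ?exprn_gt0 // exprn_ilt1 // ltW.
Qed.

(** For k > 0 the left quantity is (eps y_(k-1))^2. If k is odd, y_(k-1) < 2 bounds it by 4 eps^2 <=
    eps. If k is even, eps y_(k-1) y_(k-2) > 1 and y_(k-2) <= 2 make it larger than 1/4 >= eps. This
    is the origin of the threshold 1/4. *)
Lemma alt_sign : if odd k then x 1 ^+ 2 * eps ^+ (2 * k) < eps
                 else eps < x 1 ^+ 2 * eps ^+ (2 * k).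
Proof.
have xy : (0 < k)%N -> x 1 ^+ 2 * eps ^+ (2 * k) = (y k.-1 * eps) ^+ 2.
  move=> k0; rewrite /y; have -> : (k - k.-1 = 1)%N by lia.
  have -> : (2 * k = k.-1 + k.-1 + 1 + 1)%N by lia.
  by rewrite !exprD expr1; ring.
have [k0|k0] := posnP k.
  rewrite k0 /= muln0 expr0 mulr1.
  by have [le1 _ _] := @alt_above 1 ltac:(lia); move: eps_lt1 => ?; nra.
rewrite xy //; case: ifP => odk.
  have k1 : (k.-1 = 2 * k./2)%N by lia.
  rewrite k1; have [_ lt2] := @alt_even k./2 ltac:(lia).
  (* Strictness could only fail for k = n with k./2 = 0, that is k = n = 1, against n >= 2. *)
  have {}lt2 : y (2 * k./2) < 2 by apply: lt2; lia.
  move: (y_gt0 (2 * k./2)) lt2 eps0 eps4; move: (y _) => a a0 a2 e0 e4.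
  have h : a ^+ 2 * eps < 1 by have : a ^+ 2 < 4 by [nra]; nra.
  rewrite (_ : _ ^+ 2 = a ^+ 2 * eps * eps); last by ring.
  by rewrite gtr_pMl.
have k1 : (k.-1 = (2 * (k./2).-1).+1)%N by lia.
have [le2 _] := @alt_even (k./2).-1 ltac:(lia).
have E := @alt_step (2 * (k./2).-1) ltac:(lia).
rewrite k1; have e_gt0 : 0 < eps ^+ (2 * (2 * (k./2).-1).+1) by rewrite exprn_gt0.
have := y_gt0 (2 * (k./2).-1).+1; have := y_gt0 (2 * (k./2).-1).
move: E e_gt0 le2; move: (y _) (y _) (eps ^+ _) => a b c E c0 a2 a0 b0.
have : 1 < 2 * (b * eps) by move: eps0 => ?; nra.
by move: eps0 eps4 => ? ? ?; nra.
Qed.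

End AlternatingSequence.

(** * Sign changes of the eliminant *)

Section RealRoots.
Variables (R : rcfType) (n : nat) (eps : R).
Hypotheses (hn : (2 <= n)%N) (eps0 : 0 < eps) (eps4 : 4 * eps <= 1).
Local Notation A u := (oprod n (fun i => facval eps i u)).

Lemma facval_gt0 i u : 0 < u -> 0 < facval eps i u.
Proof.
move=> u0; rewrite /facval addr_gt0 //; first by case: ifP.
by rewrite mulr_gt0 ?exprn_gt0.
Qed.

Lemma oprod_gt0 u k : 0 < u -> 0 < A u k.
Proof. by move=> u0; rewrite /oprod prodr_gt0 // => i _; apply: facval_gt0. Qed.

Definition sign_point (k : nat) : R := eps ^+ 3 / eps ^+ (2 * k).

Lemma sign_point_gt0 k : 0 < sign_point k.
Proof. by rewrite /sign_point divr_gt0 ?exprn_gt0. Qed.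

(* The sign alternates because, in exponents of eps, x_1(u)^2 / u has slope
   alternately 1 and -1 between consecutive sign points. *)
Lemma eliminant_sign k : (k <= n.+1)%N ->
  if odd k then (eliminant n eps).[sign_point k] < 0
  else 0 < (eliminant n eps).[sign_point k].
Proof.
move=> kn; have u0 := sign_point_gt0 k; set u := sign_point k in u0 *.
(* Dividing the first coordinate by eps turns f_1 = eps + u into eps times 1 + eps^(2-2k), so the
   product relation has the same form for every i. *)
pose x i := A u i / A u i.+1 / (if i == 1%N then eps else 1).
have A0 i : 0 < A u i := oprod_gt0 i u0.
have x0 i : 0 < x i.
  by rewrite /x divr_gt0 ?divr_gt0 //; case: ifP.
have xM i : (0 < i <= n)%N -> x i * x i.+1 = 1 + eps ^+ (2 * i) / eps ^+ (2 * k).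
  move=> il; rewrite /x; have -> : (i.+1 == 1%N) = false by lia.
  rewrite divr1 (@oprod_rec _ _ _ i); last by lia.
  have A1 : A u i.+1 != 0 by rewrite gt_eqF.
  have A2 : A u i.+2 != 0 by rewrite gt_eqF.
  have d0 : (if i == 1%N then eps else 1) != 0 by case: ifP => _; rewrite ?oner_eq0 ?(gt_eqF eps0).
  have -> : facval eps i u =
            (if i == 1%N then eps else 1) * (1 + eps ^+ (2 * i) / eps ^+ (2 * k)).
    rewrite /facval /u /sign_point; case: eqP => [->|i1].
      have -> : (2 * 1 - 3 = 0)%N by []. by ring.
    rewrite mul1r mulrA -exprD; have -> : (2 * i - 3 + 3 = 2 * i)%N by lia.
    by [].
  move: (1 + _) (if _ then _ else _) d0 => c d d0.
  by field; rewrite A1 A2 d0.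
have x1 i : (n < i)%N -> x i = 1.
  move=> ni; rewrite /x; have -> : (i == 1%N) = false by lia.
  by rewrite !oprod_out ?divr1 // ltnW.
have := alt_sign eps0 eps4 hn kn x0 xM x1.
have e2k : 0 < eps ^+ (2 * k) by rewrite exprn_gt0.
have uE : u * eps ^+ (2 * k) = eps ^+ 3 by rewrite /u /sign_point mulfVK // gt_eqF.
have HE : (eliminant n eps).[u] * eps ^+ (2 * k)
          = (A u 2 * eps) ^+ 2 * (x 1 ^+ 2 * eps ^+ (2 * k) - eps).
  rewrite horner_eliminant mulrBl [u * _ * _]mulrAC uE /x /=.
  have A2 : A u 2 != 0 by rewrite gt_eqF.
  have d0 : eps != 0 by rewrite gt_eqF.
  by field; rewrite A2 d0.
have c0 : 0 < (A u 2 * eps) ^+ 2 by rewrite exprn_gt0 // mulr_gt0.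
case: ifP => _ S.
  by rewrite -(pmulr_llt0 _ e2k) HE pmulr_rlt0 // subr_lt0.
by rewrite -(pmulr_lgt0 _ e2k) HE pmulr_rgt0 // subr_gt0.
Qed.

Lemma sign_point_lt k : sign_point k < sign_point k.+1.
Proof.
rewrite /sign_point ltr_pM2l ?exprn_gt0 // ltf_pV2 ?posrE ?exprn_gt0 //.
have -> : (2 * k.+1 = 2 * k + 2)%N by lia.
rewrite exprD gtr_pMr ?exprn_gt0 // exprn_ilt1 // ?ltW //.
by move: eps0 eps4 => *; lra.
Qed.

(** The endpoints are not roots, so the bounds are strict and roots from different intervals are
    distinct. *)
Lemma real_root k : (k <= n)%N ->
  exists u, [/\ sign_point k < u, u < sign_point k.+1 & root (eliminant n eps) u].
Proof.
move=> kn; have lek : sign_point k <= sign_point k.+1 := ltW (sign_point_lt k).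
have s0 := eliminant_sign (leqW kn); have s1 := @eliminant_sign k.+1 kn.
have nz l : (l <= n.+1)%N -> (eliminant n eps).[sign_point l] != 0.
  by move=> /eliminant_sign; case: ifP => _ h; rewrite ?(gt_eqF h) ?(lt_eqF h).
have [u /andP[ku uk] Hu] : exists2 u,
    sign_point k <= u <= sign_point k.+1 & root (eliminant n eps) u.
  move: s0 s1; rewrite /=; case: (odd k) => /= s0 s1.
    by apply: poly_ivt => //; rewrite !ltW.
  have [|u ul] := @poly_ivt R (- eliminant n eps) _ _ lek.
    by rewrite !hornerN oppr_le0 oppr_ge0 !ltW.
  by rewrite rootN; exists u.
exists u; rewrite !lt_neqAle ku uk !andbT; split=> //.
  by apply: contraNneq (nz k (leqW kn)) => ->.
by apply: contraNneq (nz k.+1 kn) => <-.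
Qed.

Lemma real_config : exists u : nat -> R, root_config n eps (fun x => 0 < x) u.
Proof.
have /choice[u uP] : forall k, exists u, (k <= n)%N ->
    [/\ sign_point k < u, u < sign_point k.+1 & root (eliminant n eps) u].
  move=> k; have [/real_root[u uP]|nk] := leqP k n; first by exists u.
  by exists 0.
have u0 k : (k <= n)%N -> 0 < u k.
  by move=> /uP[h _ _]; apply: lt_trans h; apply: sign_point_gt0.
exists u; split.
- have sm : {homo sign_point : j k / (j <= k)%N >-> j <= k}.
    by apply: (homo_leq (@lexx _ _) (@le_trans _ _)) => k; apply/ltW/sign_point_lt.
  have lt j k : (j < k)%N -> (k <= n)%N -> u j < u k.
    move=> jk kn; have [_ h _] := uP j (ltnW (leq_trans jk kn)).
    have [h' _ _] := uP k kn.
    exact: lt_trans h (le_lt_trans (sm _ _ jk) h').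
  move=> j k jn kn E; case: (ltngtP j k) => // jk.
    by have := lt _ _ jk kn; rewrite E ltxx.
  by have := lt _ _ jk jn; rewrite E ltxx.
- by move=> k /uP[].
- by move=> k i kn _; apply/facval_gt0/u0.
Qed.

End RealRoots.

(** * Hensel lifting and generalized phases *)

Section Scaling.
Variables (K : fieldType) (n j : nat) (eps : K).
Hypotheses (hn : (2 <= n)%N) (eps0 : eps != 0) (jn : (j <= n)%N).

(* The leading term of x_i at the root u ~ eps^(2 - 2j). *)
Definition lead_coord (i : nat) : K :=
  if i == 1%N then eps / eps ^+ j else (eps ^+ (j.+1 - i))^-1.

(** f_i stripped of its leading power of eps: for i <= j the term in u dominates, for i > j the
    constant term does. *)
Definition scaled_fac (w : K) (i : nat) : K :=
  if (i <= j)%N then w + eps ^+ (2 * (j - i)).+1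
  else 1 + eps ^+ (2 * (i - j.+1)).+1 * w.

Definition unscale (w : K) : K := eps ^+ 2 / eps ^+ (2 * j) * w.

Lemma facval_scale w i : (0 < i)%N ->
  facval eps i (unscale w) = lead_coord i * lead_coord i.+1 * scaled_fac w i.
Proof.
have e0 m : eps ^+ m != 0 by rewrite expf_neq0.
case: i => // -[_|i _]; rewrite /facval /lead_coord /scaled_fac /unscale /=.
  have -> : (2 * 1 - 3 = 0)%N by [].
  case: j => [|j'] /=; first by rewrite !muln0 !expr0 !divr1; ring.
  have -> : (2 * j'.+1 = j' + j' + 1 + 1)%N by lia.
  have -> : (j'.+2 - 2 = j')%N by lia.
  have -> : ((2 * (j'.+1 - 1)).+1 = j' + j' + 1)%N by lia.
  rewrite -[j'.+1]addn1 !exprD !expr1; field.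
  by rewrite eps0 e0.
have -> : (2 * i.+2 - 3 = 2 * i + 1)%N by lia.
case: ltnP => ij.
  have -> : (j.+1 - i.+2 = (j - i.+2) + 1)%N by lia.
  have -> : (j.+1 - i.+3 = j - i.+2)%N by lia.
  have -> : ((2 * (j - i.+2)).+1 = (j - i.+2) + (j - i.+2) + 1)%N by lia.
  have -> : (2 * j = 2 * i + (j - i.+2) + (j - i.+2) + 4)%N by lia.
  rewrite !exprD; field.
  by rewrite eps0 !e0.
have -> : (j.+1 - i.+2 = 0)%N by lia.
have -> : (j.+1 - i.+3 = 0)%N by lia.
have -> : (2 * i + 1 = 2 * j + (2 * (i.+2 - j.+1)).+1 - 2)%N by lia.
rewrite expr0 invr1 !mul1r; congr (1 + _).
have E : eps ^+ (2 * j + (2 * (i.+2 - j.+1)).+1 - 2) * eps ^+ 2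
         = eps ^+ (2 * j) * eps ^+ (2 * (i.+2 - j.+1)).+1.
  by rewrite -!exprD; congr (_ ^+ _); lia.
rewrite mulrA [X in X * w]mulrA E; field.
exact: e0.
Qed.

(** The leading powers are pulled out of A_1 and A_2 by [oprod_scale]. Since u = [lead_coord 1] ^ 2
    w, the terms A_1^2 and u A_2^2 acquire the same factor c. *)
Lemma eliminant_scale w : exists2 c, c != 0 &
  (eliminant n eps).[unscale w] =
  c * (oprod n (scaled_fac w) 1 ^+ 2 - w * oprod n (scaled_fac w) 2 ^+ 2).
Proof.
have e0 m : eps ^+ m != 0 by rewrite expf_neq0.
have l0 i : lead_coord i != 0.
  by rewrite /lead_coord; case: ifP => _; rewrite ?mulf_neq0 ?invr_neq0.
have ln : lead_coord n.+1 = 1.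
  rewrite /lead_coord; have -> : (n.+1 == 1%N) = false by lia.
  have -> : (j.+1 - n.+1 = 0)%N by lia.
  by rewrite expr0 invr1.
have fE i : (1 <= i <= n)%N -> facval eps i (unscale w) = _ :=
  fun h => facval_scale w (proj1 (andP h)).
rewrite horner_eliminant !(oprod_scale ln fE) // (@big_ltn _ _ _ 1); last by lia.
exists ((\prod_(2 <= i < n.+1) lead_coord i * lead_coord 1) ^+ 2).
  by rewrite expf_neq0 // mulf_neq0 // prodf_seq_neq0; apply/allP => i _; apply/implyP.
have -> : unscale w = lead_coord 1 ^+ 2 * w.
  by rewrite /unscale /lead_coord /= expr_div_n -exprM mulnC.
by ring.
Qed.

End Scaling.

(** * Adic completeness of subrings of a field *)

Section SubringSets.
Variable L : fieldType.
Implicit Types (A : set L) (x y : L).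

Definition is_subring A : Prop :=
  [/\ A 1, forall x y, A x -> A y -> A (x - y)
    & forall x y, A x -> A y -> A (x * y)].

Lemma is_subring1 A : is_subring A -> A 1. Proof. by case. Qed.
Lemma is_subringB A : is_subring A -> forall x y, A x -> A y -> A (x - y).
Proof. by case. Qed.
Lemma is_subringM A : is_subring A -> forall x y, A x -> A y -> A (x * y).
Proof. by case. Qed.
Lemma is_subring0 A : is_subring A -> A 0.
Proof. by move=> [A1 AB _]; rewrite -(subrr 1); apply: AB. Qed.
Lemma is_subringN A : is_subring A -> forall x, A x -> A (- x).
Proof.
by move=> sA x Ax; rewrite -sub0r; apply: is_subringB => //; apply: is_subring0.
Qed.
Lemma is_subringD A : is_subring A -> forall x y, A x -> A y -> A (x + y).
Proof.
move=> sA x y Ax Ay; rewrite -[y]opprK.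
by apply: is_subringB => //; apply: is_subringN.
Qed.
Lemma is_subringX A : is_subring A -> forall x m, A x -> A (x ^+ m).
Proof.
move=> sA x m Ax; elim: m => [|m IH]; first exact: is_subring1.
by rewrite exprS; apply: is_subringM.
Qed.

(** Convergence of pi-adic series, expressed by the remainders; m = 0 places the sum w in A. *)
Definition adic_complete A (pi : L) : Prop :=
  forall a : nat -> L, (forall k, A (a k)) ->
  exists w, forall m, exists2 b, A b & w = \sum_(k < m) pi ^+ k * a k + pi ^+ m * b.

Definition adic_separated A (pi : L) : Prop :=
  forall x, (forall m, exists2 b, A b & x = pi ^+ m * b) -> x = 0.

End SubringSets.

Ltac subring := repeat first
  [ assumption
  | match goal with H : is_subring ?A |- ?A _ =>
      first [ apply: (is_subring1 H) | apply: (is_subring0 H)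
            | apply: (is_subringB H) | apply: (is_subringN H)
            | apply: (is_subringD H) | apply: (is_subringX H)
            | apply: (is_subringM H) ] end ].

(** * Hensel's lemma by successive approximation *)

Section Hensel.
Variables (L : fieldType) (A : set L) (eps pi b : L) (N : nat).
Hypotheses (sA : is_subring A) (Aeps : A eps) (Api : A pi) (Ab : A b).
Hypothesis epsN : eps ^+ N = pi * b.
Hypotheses (Acomp : adic_complete A pi) (Asep : adic_separated A pi).

(** The divided-difference property of polynomial functions over A. It is closed under sums and
    products, so the remainder terms need no explicit polynomial. *)
Definition lipschitz (g : L -> L) : Prop := forall w w', A w -> A w' ->
  A (g w) /\ exists2 c, A c & g w - g w' = (w - w') * c.

Lemma lipschitz_cst c : A c -> lipschitz (fun=> c).
Proof. by move=> Ac w w' _ _; split=> //; exists 0; [subring | rewrite subrr mulr0]. Qed.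

Lemma lipschitz_id : lipschitz id.
Proof. by move=> w w' Aw _; split=> //; exists 1; [subring | rewrite mulr1]. Qed.

Lemma lipschitzD f g : lipschitz f -> lipschitz g -> lipschitz (fun w => f w + g w).
Proof.
move=> lf lg w w' Aw Aw'; have [Af [c Ac fE]] := lf _ _ Aw Aw'.
have [Ag [d Ad gE]] := lg _ _ Aw Aw'; split; first by subring.
exists (c + d); first by subring.
by rewrite mulrDr -fE -gE; ring.
Qed.

Lemma lipschitzM f g : lipschitz f -> lipschitz g -> lipschitz (fun w => f w * g w).
Proof.
move=> lf lg w w' Aw Aw'; have [Af [c Ac fE]] := lf _ _ Aw Aw'.
have [Ag [d Ad gE]] := lg _ _ Aw Aw'; have [Af' _] := lf _ _ Aw' Aw.
split; first by subring.
exists (c * g w + f w' * d); first by subring.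
rewrite mulrDr !mulrA -fE [_ * f w']mulrC -[f w' * _ * _]mulrA -gE.
by ring.
Qed.

Lemma lipschitzX m : lipschitz (fun w => w ^+ m).
Proof.
elim: m => [|m IH]; first by apply: lipschitz_cst; subring.
move=> w w' Aw Aw'; rewrite !exprS.
exact: (lipschitzM lipschitz_id IH).
Qed.

Section Iteration.
Variables (j : nat) (g : L -> L).
Hypothesis lg : lipschitz g.

Let h w := w ^+ j * (w - 1) + eps * g w.

Lemma lipschitz_hensel : lipschitz h.
Proof.
apply: lipschitzD; apply: lipschitzM => //; first exact: lipschitzX.
  apply: lipschitzD; first exact: lipschitz_id.
  by apply: lipschitz_cst; subring.
exact: lipschitz_cst.
Qed.

(** Near 1 the map h has slope 1 modulo eps, because w^j (w - 1) has derivative 1 at w = 1. *)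
Lemma hensel_slope a a' (w := 1 + eps * a) (w' := 1 + eps * a') : A a -> A a' ->
  exists2 c, A c & h w - h w' = (w - w') * (1 + eps * c).
Proof.
move=> Aa Aa'.
have Aw : A w by rewrite /w; subring.
have Aw' : A w' by rewrite /w'; subring.
have A1 := is_subring1 sA.
have [_ [c1 Ac1 E1]] := lipschitzX j Aw A1.
have [_ [c2 Ac2 E2]] := lipschitzX j Aw Aw'.
have [_ [c3 Ac3 E3]] := lg Aw Aw'.
exists (a * c1 + c2 * a' + c3); first by subring.
have -> : h w - h w' = w ^+ j * (w - w') + (w ^+ j - w' ^+ j) * (w' - 1)
                       + eps * (g w - g w') by rewrite /h; ring.
rewrite E2 E3.
move: E1; rewrite expr1n => /eqP; rewrite subr_eq => /eqP ->.
by rewrite /w /w'; ring.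
Qed.

(** Newton's iteration with the derivative replaced by 1. *)
Let W k := iter k (fun w => w - h w) 1.

(** By the slope estimate h(w - h(w)) = - eps c h(w), so each step gains a factor eps while staying
    in 1 + eps A. *)
Lemma hensel_iter k :
  (exists2 a, A a & W k = 1 + eps * a) /\
  (exists2 d, A d & h (W k) = eps ^+ k.+1 * d).
Proof.
have A1 := is_subring1 sA.
elim: k => [|k [[a Aa Wk] [d Ad hd]]].
  split; first by exists 0; [subring | rewrite mulr0 addr0].
  exists (g 1); first by have [] := lg A1 A1.
  by rewrite /h /= subrr mulr0 add0r expr1.
have WS : W k.+1 = 1 + eps * (a - eps ^+ k * d).
  by rewrite /W iterS -/(W k) hd Wk exprS; ring.
have Aa' : A (a - eps ^+ k * d) by subring.
split; first by exists (a - eps ^+ k * d).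
have [c Ac E] := hensel_slope Aa' Aa.
exists (- (c * d)); first by subring.
move: E; rewrite -WS -Wk => /eqP; rewrite subr_eq => /eqP ->.
rewrite (_ : W k.+1 - W k = - h (W k)); last by rewrite /W iterS -/(W k); ring.
by rewrite hd [in RHS]exprS; ring.
Qed.

Lemma hensel_block k r : exists2 e, A e & W (k + r) - W k = eps ^+ k * e.
Proof.
elim: r => [|r [e Ae E]]; first by exists 0; [subring | rewrite addn0 subrr mulr0].
have [_ [d Ad hd]] := hensel_iter (k + r).
exists (e - eps ^+ r.+1 * d); first by subring.
rewrite addnS {1}/W iterS -/(W (k + r)) addrAC E hd -addnS exprD; ring.
Qed.

(** The iteration converges eps-adically while A is complete for pi. Grouping N steps makes the m-th
    block a multiple of eps^(Nm) = pi^m b^m, so the iterates W(Nm) are partial sums of a pi-adic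
    series. The value of h at the limit is divisible by every pi^m, hence zero. *)
Lemma hensel : exists w a c, [/\ A a, A c, w = 1 + eps * a + pi * c
  & w ^+ j * (w - 1) + eps * g w = 0].
Proof.
have /choice[e eP] : forall m, exists e,
    A e /\ W (N * m.+1) - W (N * m) = eps ^+ (N * m) * e.
  by move=> m; have [e Ae E] := hensel_block (N * m) N; exists e; rewrite mulnS addnC.
have bmA m : A (b ^+ m * e m) by have [Ae _] := eP m; subring.
have [w0 w0P] := Acomp bmA.
have epsNm m : eps ^+ (N * m) = pi ^+ m * b ^+ m by rewrite exprM epsN exprMn.
have WN m : W (N * m) = 1 + \sum_(k < m) pi ^+ k * (b ^+ k * e k).
  elim: m => [|m IH]; first by rewrite muln0 big_ord0 addr0.
  have [_ /eqP] := eP m; rewrite subr_eq => /eqP ->.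
  by rewrite IH big_ord_recr /= epsNm; ring.
have wP m : exists2 c, A c & 1 + w0 = W (N * m) + pi ^+ m * c.
  by have [c Ac E] := w0P m; exists c; rewrite // E WN addrA.
have [c Ac wE] := wP 1%N; have [[a Aa Wa] _] := hensel_iter (N * 1).
exists (1 + w0), a, c; split=> //; first by rewrite wE Wa expr1.
apply: Asep => m; have [d Ad wm] := wP m.
have [[a' Aa' Wa'] [d' Ad' hd']] := hensel_iter (N * m).
have AW : A (W (N * m)) by rewrite Wa'; subring.
have Aw : A (1 + w0) by rewrite wm; subring.
have [_ [c' Ac' E]] := lipschitz_hensel Aw AW.
exists (b ^+ m * eps * d' + d * c'); first by subring.
move: E => /eqP; rewrite subr_eq => /eqP.
rewrite hd' {2}wm [W _ + _]addrC addrK exprSr epsNm => E.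
by rewrite -[LHS]/(h _) E; ring.
Qed.

End Iteration.

Definition congr_monomial (a : nat) (f : L -> L) : Prop :=
  exists2 g, lipschitz g & forall w, f w = w ^+ a + eps * g w.

Lemma congr_monomialM a c f g : congr_monomial a f -> congr_monomial c g ->
  congr_monomial (a + c) (fun w => f w * g w).
Proof.
move=> [f1 lf fE] [g1 lg gE].
exists (fun w => w ^+ a * g1 w + (f1 w * w ^+ c + eps * (f1 w * g1 w))).
  apply: lipschitzD; first exact: lipschitzM (lipschitzX a) lg.
  apply: lipschitzD; first exact: lipschitzM lf (lipschitzX c).
  by apply: lipschitzM (lipschitz_cst Aeps) _; apply: lipschitzM.
by move=> w; rewrite fE gE exprD; ring.
Qed.

Lemma congr_monomial_fac j i :
  congr_monomial (i <= j)%N (fun w => scaled_fac j eps w i).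
Proof.
rewrite /scaled_fac; case: leqP => _ /=.
  exists (fun=> eps ^+ (2 * (j - i))); first by apply: lipschitz_cst; subring.
  by move=> w; rewrite expr1 exprS.
exists (fun w => eps ^+ (2 * (i - j.+1)) * w).
  by apply: lipschitzM lipschitz_id; apply: lipschitz_cst; subring.
by move=> w; rewrite expr0 exprS mulrA.
Qed.

(** Only the factors with index i <= j contribute a w modulo eps; the exponent counts those with i
    >= k and i = k mod 2. *)
Lemma congr_monomial_oprod n j k : (j <= n)%N ->
  congr_monomial (j.+2 - k)./2 (fun w => oprod n (scaled_fac j eps w) k).
Proof.
move=> jn; elim/(@down_ind2 n): k => k kn.
  have -> : ((j.+2 - k)./2 = 0)%N by lia.
  exists (fun=> 0); first by apply: lipschitz_cst; subring.
  by move=> w; rewrite oprod_out // mulr0 addr0 expr0.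
move=> IH; have [g lg gE] := congr_monomialM (congr_monomial_fac j k) IH.
have -> : ((j.+2 - k)./2 = (k <= j) + (j.+2 - k.+2)./2)%N.
  by case: leqP => ?; lia.
by exists g => // w; rewrite oprod_rec // gE.
Qed.

(** Modulo eps, A_1^2 and w A_2^2 become w^(j+1) and w^j for j odd, and w^j and w^(j+1) for j even.
    The difference is w^j (w - 1) up to sign, and Hensel's lemma applies. *)
Lemma scaled_root n j : (j <= n)%N -> exists w a c,
  [/\ A a, A c, w = 1 + eps * a + pi * c
    & oprod n (scaled_fac j eps w) 1 ^+ 2
      - w * oprod n (scaled_fac j eps w) 2 ^+ 2 = 0].
Proof.
move=> jn; have c1 := congr_monomial_oprod 1 jn; have c2 := congr_monomial_oprod 2 jn.
have [g1 lg1 gE1] := congr_monomialM c1 c1.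
have [g2 lg2 gE2] := congr_monomialM c2 c2.
have lN1 : lipschitz (fun=> -1) by apply: lipschitz_cst; subring.
case odj: (odd j).
  have lg : lipschitz (fun w => g1 w + -1 * (w * g2 w)).
    by apply: lipschitzD => //; apply: lipschitzM => //; apply: lipschitzM lipschitz_id _.
  have [w [a [c [Aa Ac wE E]]]] := hensel j lg.
  exists w, a, c; split=> //; rewrite -[RHS]E !expr2 gE1 gE2.
  have -> : (((j.+2 - 1)./2 + (j.+2 - 1)./2) = j + 1)%N by lia.
  have wj : w ^+ j = w * w ^+ ((j.+2 - 2)./2 + (j.+2 - 2)./2)%N.
    by rewrite -exprS; congr (_ ^+ _); lia.
  by rewrite exprD expr1 wj; ring.
have lg : lipschitz (fun w => w * g2 w + -1 * g1 w).
  by apply: lipschitzD => //; apply: lipschitzM => //; apply: lipschitz_id.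
have [w [a [c [Aa Ac wE E]]]] := hensel j lg.
exists w, a, c; split=> //; rewrite -[RHS]oppr0 -E !expr2 gE1 gE2.
have -> : ((j.+2 - 1)./2 + (j.+2 - 1)./2 = j)%N by lia.
have -> : ((j.+2 - 2)./2 + (j.+2 - 2)./2 = j)%N by lia.
by ring.
Qed.

End Hensel.

(** * The group of elements of phase one *)

Section Phase.
Variables (L : fieldType) (O : set L) (rho : L).
Hypotheses (sO : is_subring O) (Orho : O rho) (rho0 : rho != 0).
Hypotheses (rhoV : ~ O rho^-1) (unit1 : forall x, O x -> O (1 + rho * x)^-1).

(** The subgroup generated by rho and the elements of 1 + rho O, which is easier to multiply and
    invert in than residue classes. *)
Definition phase_class (y : L) : Prop :=
  exists k : int, exists2 o, O o & y = rho ^ k * (1 + rho * o).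

Lemma rho_mul_neq1 x : O x -> rho * x != 1.
Proof.
move=> Ox; apply/eqP => E; apply: rhoV.
by rewrite -[rho^-1]mulr1 -E mulKf.
Qed.

Lemma unit1_neq0 x : O x -> 1 + rho * x != 0.
Proof.
move=> Ox; rewrite addr_eq0 eq_sym -mulrN.
by apply: rho_mul_neq1; subring.
Qed.

Lemma phase_class1 x : O x -> phase_class (1 + rho * x).
Proof. by move=> Ox; exists 0, x; rewrite // expr0z mul1r. Qed.

Lemma phase_class_subgroup : mult_subgroup phase_class.
Proof.
split.
- by rewrite -(addr0 1) -(mulr0 rho); apply: phase_class1; subring.
- move=> [k [o Oo /esym/eqP]]; apply/negP.
  by rewrite mulf_neq0 ?expfz_neq0 ?unit1_neq0.
- move=> x y [k [o Oo ->]] [l [o' Oo' ->]].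
  exists (k + l), (o + o' + rho * o * o'); first by subring.
  by rewrite expfzDr //; ring.
- move=> x [k [o Oo ->]]; exists (- k), (- (o * (1 + rho * o)^-1)).
    by have := unit1 Oo => ?; subring.
  rewrite invfM invr_expz; congr (_ * _).
  have u0 := unit1_neq0 Oo; apply: (mulfI u0).
  by rewrite mulfV //; field.
Qed.

Lemma integer_unit_rho a m : integer_unit O a -> ~ integer_unit O (a * rho ^+ m.+1).
Proof.
move=> [a0 Oa _] [_ _]; rewrite invfM => h; apply: rhoV.
have -> : rho^-1 = a^-1 / rho ^+ m.+1 * (a * rho ^+ m).
  by rewrite exprS; field; rewrite a0 rho0 expf_neq0.
by subring.
Qed.

(** [na_ord] is a choice among exponents. Two different ones would make a unit times a positive
    power of rho a unit, and rho^-1 would be integral. *)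
Lemma na_ord_unique y k : integer_unit O (y / rho ^ k) -> na_ord O rho y = k.
Proof.
move=> yk; rewrite /na_ord; case: xgetP => [l _ yl|/(_ k)//].
have key k' l' : integer_unit O (y / rho ^ k') -> integer_unit O (y / rho ^ l') ->
    ~ (l' < k').
  move=> yk' yl' lk.
  have [m kE] : exists m : nat, k' = l' + m.+1%:Z.
    by exists `|k' - l'|%N.-1; lia.
  apply: (integer_unit_rho (m := m) yk').
  suff -> : y / rho ^ k' * rho ^+ m.+1 = y / rho ^ l' by [].
  rewrite kE expfzDr // -exprnP; field.
  by rewrite expfz_neq0 ?expf_neq0.
by case: (ltgtP l k) => // h; [have := key _ _ yk yl h | have := key _ _ yl yk h].
Qed.

(** Closure of the set of non-units under adding rho O: if v = x + rho o were a unit, so would be x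
    = v (1 - rho o / v). *)
Lemma maximal_ideal_add x o : maximal_ideal O x -> O o ->
  maximal_ideal O (x + rho * o).
Proof.
move=> [Ox xN] Oo; split; first by subring.
move=> [v0 Ov OvV]; apply: xN; set v := x + rho * o in v0 Ov OvV.
have Oov : O (- (o * v^-1)) by subring.
have -> : x = v * (1 + rho * (- (o * v^-1))) by rewrite /v; field.
have u0 := unit1_neq0 Oov; have Ou := unit1 Oov.
split; [by rewrite mulf_neq0 | by subring |].
by rewrite invfM; subring.
Qed.

Lemma phase_class_one y : phase_class y -> na_phase_one O rho y.
Proof.
move=> [k [o Oo yE]].
have yk : y / rho ^ k = 1 + rho * o by rewrite yE mulrAC mulfV ?mul1r ?expfz_neq0.
have yu : integer_unit O (y / rho ^ k).
  by rewrite yk; split; [exact: unit1_neq0 | subring | exact: unit1].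
rewrite /na_phase_one /na_phase (na_ord_unique yu) yk /residue.
apply/seteqP; split=> z /= Mz.
  have -> : z - 1 = z - (1 + rho * o) + rho * o by ring.
  exact: maximal_ideal_add.
have -> : z - (1 + rho * o) = z - 1 + rho * (- o) by ring.
by apply: maximal_ideal_add => //; subring.
Qed.

Section Config.
Variables (A : set L) (eps pi b eo po : L) (n N : nat).
Hypotheses (hn : (2 <= n)%N) (sA : is_subring A) (AO : A `<=` O).
Hypotheses (Aeps : A eps) (Api : A pi) (Ab : A b) (epsN : eps ^+ N = pi * b).
Hypotheses (Oeo : O eo) (Opo : O po) (epsE : eps = rho * eo) (piE : pi = rho * po).
Hypotheses (eps0 : eps != 0) (epsP : phase_class eps).
Hypotheses (Acomp : adic_complete A pi) (Asep : adic_separated A pi).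

Lemma nonarch_eps2 : eps ^+ 2 != 1.
Proof.
rewrite expr2 {1}epsE -mulrA; apply: rho_mul_neq1.
by have := AO Aeps => ?; subring.
Qed.

(** The roots are eps^(2-2j) w_j with w_j in 1 + rho O. A is the ring in which Hensel's lemma is
    run, O the one that defines phases. *)
Lemma nonarch_config : exists u, root_config n eps phase_class u.
Proof.
have Oeps := AO Aeps.
have [P1 P0 PM PV] := phase_class_subgroup.
have PX x m : phase_class x -> phase_class (x ^+ m).
  by move=> Px; elim: m => // m IH; rewrite exprS; apply: PM.
have /choice[w wP] : forall j, exists w, (j <= n)%N ->
    (exists2 c, O c & w = 1 + rho * c) /\
    oprod n (scaled_fac j eps w) 1 ^+ 2
      - w * oprod n (scaled_fac j eps w) 2 ^+ 2 = 0.
  move=> j; have [jn|_] := leqP j n; last by exists 0.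
  have [w [a [c [/AO Aa /AO Ac wE E]]]] := scaled_root sA Aeps Api Ab epsN Acomp Asep jn.
  exists w => _; split=> //; exists (eo * a + po * c); first by subring.
  by rewrite wE epsE piE; ring.
exists (fun j => unscale j eps (w j)); split.
- have key j k : (j < k)%N -> (k <= n)%N ->
      unscale j eps (w j) <> unscale k eps (w k).
    move=> jk kn; have [[c Oc wj] _] := wP j (ltnW (leq_trans jk kn)).
    have [[d Od wk] _] := wP k kn; rewrite /unscale => E.
    have [m kE] : exists m, (2 * k = 2 * j + m.+1)%N by exists (2 * (k - j)).-1; lia.
    have Ew : w j * eps ^+ m.+1 = w k.
      apply: (mulfI (x := eps ^+ 2 / eps ^+ (2 * k))).
        by rewrite mulf_neq0 ?invr_neq0 ?expf_neq0.
      rewrite -E kE [in LHS]exprD; field.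
      by rewrite !expf_neq0.
    (* If the roots for j < k agree, then w_k = eps^(2(k-j)) w_j is divisible by rho, although w_k =
       1 + rho d. *)
    have : rho * (eo * eps ^+ m * w j - d) != 1.
      by apply: rho_mul_neq1; rewrite wj; subring.
    move/eqP; apply; rewrite mulrBr.
    have -> : rho * (eo * eps ^+ m * w j) = w j * eps ^+ m.+1.
      by rewrite exprS [X in _ = _ * (X * _)]epsE; ring.
    by rewrite Ew wk; ring.
  move=> j k jn kn E; case: (ltngtP j k) => // h.
    by have := key _ _ h kn E.
  by have := key _ _ h jn (esym E).
- move=> k kn; have [_ wk] := wP k kn.
  have [c c0 E] := eliminant_scale hn eps0 kn (w k).
  by rewrite /root E wk mulr0.
- move=> k i kn /andP[i0 _]; have [[c Oc wE] _] := wP k kn.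
  rewrite (facval_scale (n := n)) //.
  have Pl l : phase_class (lead_coord k eps l).
    rewrite /lead_coord; case: ifP => _; last by apply/PV/PX.
    by apply: PM => //; apply/PV/PX.
  apply: (PM _ _ (PM _ _ (Pl i) (Pl i.+1))).
  rewrite /scaled_fac wE; case: ifP => _.
    rewrite exprS {1}epsE (_ : _ + _ * _ * _ = 1 + rho * (c + eo * eps ^+ (2 * (k - i)))).
      by apply: phase_class1; subring.
    by ring.
  rewrite exprS {1}epsE -!mulrA; apply: phase_class1; subring.
Qed.

End Config.
End Phase.

(** * Consequences of having a uniformizer *)

Section Uniformizer.
Variables (L : fieldType) (O : set L) (rho : L).
Hypotheses (sO : is_subring O) (rhoU : uniformizer O rho).

Lemma uniformizer_mem x : maximal_ideal O x -> exists2 o, O o & x = rho * o.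
Proof. by rewrite rhoU => -[o Oo <-]; exists o. Qed.

Lemma maximal_ideal_rho o : O o -> maximal_ideal O (rho * o).
Proof. by move=> Oo; rewrite rhoU; exists o. Qed.

Lemma uniformizer_int : O rho.
Proof.
by have := maximal_ideal_rho (is_subring1 sO); rewrite mulr1 => -[].
Qed.

Lemma uniformizerV : rho != 0 -> ~ O rho^-1.
Proof.
move=> rho0 OV; have := maximal_ideal_rho (is_subring1 sO).
by rewrite mulr1 => -[Or]; apply; split.
Qed.

(** Otherwise 1 + rho x is a non-unit, hence rho o, and rho (o - x) = 1 makes rho invertible in
    O. *)
Lemma uniformizer_unit x : O x -> O (1 + rho * x)^-1.
Proof.
move=> Ox; apply: contrapT => nO.
have Or := uniformizer_int.
have : maximal_ideal O (1 + rho * x).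
  by split; [subring | move=> [_ _]].
move=> /uniformizer_mem[o Oo E].
have E1 : rho * (o - x) = 1 by rewrite mulrBr -E; ring.
have rho0 : rho != 0 by apply/eqP => r0; move/eqP: E1; rewrite r0 mul0r eq_sym oner_eq0.
apply: (uniformizerV rho0); rewrite -[rho^-1]mulr1 -E1 mulKf //.
by subring.
Qed.

Lemma phase_one_ord_gt0 y : na_phase_one O rho y -> (0 < na_ord O rho y)%R ->
  rho != 0 /\ exists e o, O o /\ y = rho ^+ e.+1 * (1 + rho * o).
Proof.
rewrite /na_phase_one /na_phase.
(* The default order is 0, so positivity guarantees a genuine exponent. *)
rewrite /na_ord; case: xgetP => [k _ [yk0 _ _]|_ _]; last by rewrite ltxx.
move=> E k_gt0; have rk0 : rho ^ k != 0.
  by apply: contraNneq yk0 => ->; rewrite invr0 mulr0.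
have : residue O 1 1.
  by rewrite /residue /= subrr; split; [subring | move=> []; rewrite eqxx].
rewrite -E /residue /= => /uniformizer_mem[o Oo oE].
case: k k_gt0 yk0 rk0 E oE => [[|e]|//] // _ yk0 rk0 E oE; split.
  by apply: contraNneq rk0 => ->; rewrite -exprnP expr0n.
exists e, (- o); split; first by subring.
by rewrite mulrN -oE opprB addrC subrK mulrC mulfVK.
Qed.

End Uniformizer.

(** * Complete discrete valuation rings *)

Lemma tofrac_inj (D : idomainType) : injective (@tofrac D).
Proof. by move=> x y /eqP; rewrite tofrac_eq => /eqP. Qed.

(* For such a D the series sum_k pi^k c_k converge, as they satisfy the
   recurrence of the first clause. *)
Definition complete_dvr (D : idomainType) (pi : D) : Prop :=
  [/\ exists S : (nat -> D) -> D, forall c, S c = c 0%N + pi * S (fun k => c k.+1),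
      forall x, (forall m, exists b, x = pi ^+ m * b) -> x = 0,
      pi != 0, forall y, pi * y != 1
    & forall x, (exists y, x = pi * y) \/ exists a y, a * x = 1 + pi * y].

(** Hensel's lemma with eps = pi, j = 0 and g(w) = w x: the equation w - 1 + pi w x = 0 says that w
    inverts 1 + pi x. *)
Lemma adic_unit (L : fieldType) (A : set L) (pi x : L) :
  is_subring A -> A pi -> adic_complete A pi -> adic_separated A pi -> A x ->
  exists2 w, A w & w * (1 + pi * x) = 1.
Proof.
move=> sA Api Ac As Ax.
have lx : lipschitz A (fun w => w * x).
  by apply: lipschitzM => //; [exact: lipschitz_id | exact: lipschitz_cst].
have pi1 : pi ^+ 1 = pi * 1 by rewrite expr1 mulr1.
have [w [a [c [Aa Ac' wE E]]]] :=
  hensel sA Api Api (is_subring1 sA) pi1 Ac As 0 lx.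
exists w; first by rewrite wE; subring.
by apply/eqP; rewrite -subr_eq0 -E; apply/eqP; rewrite expr0; ring.
Qed.

Section CompleteDvr.
Variables (D : idomainType) (pi : D).
Hypothesis DP : complete_dvr pi.

Lemma adic_sum : exists S : (nat -> D) -> D, forall c m,
  S c = \sum_(k < m) pi ^+ k * c k + pi ^+ m * S (fun k => c (m + k)%N).
Proof.
have [[S SE] _ _ _ _] := DP; exists S => c m; elim: m c => [|m IH] c.
  by rewrite big_ord0 add0r mul1r.
rewrite big_ord_recr /= {1}IH SE addn0 mulrDr addrA exprSr mulrA.
by congr (_ + _ * S _); apply/funext => k; rewrite addnS.
Qed.

Definition frac_integers : set {fraction D} := range (@tofrac D).

Lemma frac_integers_subring : is_subring frac_integers.
Proof.
split=> [|_ _ [x _ <-] [y _ <-]|_ _ [x _ <-] [y _ <-]].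
- by exists 1; rewrite ?rmorph1.
- by exists (x - y); rewrite ?rmorphB.
- by exists (x * y); rewrite ?rmorphM.
Qed.

Lemma frac_integers_complete : adic_complete frac_integers (tofrac pi).
Proof.
move=> a aO; have [S SE] := adic_sum.
have /choice[c cE] : forall k, exists c, a k = tofrac c.
  by move=> k; have [c _ <-] := aO k; exists c.
exists (tofrac (S c)) => m; exists (tofrac (S (fun k => c (m + k)%N))).
  by exists (S (fun k => c (m + k)%N)).
rewrite (SE c m) rmorphD rmorphM rmorphXn rmorph_sum; congr (_ + _).
by apply: eq_bigr => k _; rewrite rmorphM rmorphXn cE.
Qed.

Lemma frac_integers_separated : adic_separated frac_integers (tofrac pi).
Proof.
have [_ sep _ _ _] := DP; move=> x xP.
have [_ [x0 _ <-] xE] := xP 0%N; move: xP; rewrite xE expr0 mul1r => xP.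
rewrite (sep x0) ?rmorph0 // => m; have [_ [b _ <-]] := xP m.
by rewrite -rmorphXn -rmorphM => /tofrac_inj ->; exists b.
Qed.

(** An inverse modulo pi is corrected to an inverse by inverting 1 + pi y. *)
Lemma complete_dvr_unit x : (forall y, x <> pi * y) -> exists z, z * x = 1.
Proof.
have [_ _ _ _ dich] := DP; move=> xN.
have [[y /xN//]|[a [y E]]] := dich x.
have Oy : frac_integers (tofrac y) by exists y.
have Opi : frac_integers (tofrac pi) by exists pi.
have [_ [w _ <-] wE] := adic_unit frac_integers_subring Opi
  frac_integers_complete frac_integers_separated Oy.
exists (w * a); rewrite -mulrA E; apply: tofrac_inj.
by rewrite rmorphM rmorphD rmorphM rmorph1.
Qed.

Lemma frac_nonunit x : maximal_ideal frac_integers x ->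
  exists2 o, frac_integers o & x = tofrac pi * o.
Proof.
move=> [[y _ <-] yN].
have [[z ->]|yP] := pselect (exists z, y = pi * z).
  by exists (tofrac z); [exists z | rewrite rmorphM].
have [z zy] : exists z, z * y = 1.
  by apply: complete_dvr_unit => z yz; apply: yP; exists z.
have E : tofrac z * tofrac y = 1 by rewrite -rmorphM zy rmorph1.
case: yN; have y0 : tofrac y != 0.
  by apply: contra_eq_neq E => ->; rewrite mulr0 eq_sym oner_eq0.
split=> //; first by exists y.
by exists z => //; rewrite -[RHS]mul1r -E mulfK.
Qed.

Lemma frac_pi_neq0 : tofrac pi != 0.
Proof. by have [_ _ pi0 _ _] := DP; rewrite tofrac_eq0. Qed.

Lemma frac_piV : ~ frac_integers (tofrac pi)^-1.
Proof.
have [_ _ pi0 pi1 _] := DP => -[y _ yE].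
have /negP[] := pi1 y; rewrite -tofrac_eq tofracM tofrac1 yE.
by rewrite mulfV // frac_pi_neq0.
Qed.

Lemma frac_pi_unit x : frac_integers x -> frac_integers (1 + tofrac pi * x)^-1.
Proof.
move=> Ox; have Opi : frac_integers (tofrac pi) by exists pi.
have [w Ow wE] := adic_unit frac_integers_subring Opi
  frac_integers_complete frac_integers_separated Ox.
have z0 : 1 + tofrac pi * x != 0.
  by apply: contra_eq_neq wE => ->; rewrite mulr0 eq_sym oner_eq0.
by have -> : (1 + tofrac pi * x)^-1 = w by apply: (mulIf z0); rewrite mulVf.
Qed.

End CompleteDvr.

(** * The p-adic integers *)

Section PadicDvr.
Variables (p : nat) (p_pr : prime p).
Local Notation Zp := (padic_int p_pr).

Lemma padic_resD (x y : Zp) k : (x + y) k = x k + y k. Proof. by []. Qed.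
Lemma padic_resM (x y : Zp) k : (x * y) k = x k * y k. Proof. by []. Qed.
Lemma padic_res0 k : (0 : Zp) k = 0. Proof. by []. Qed.
Lemma padic_res1 k : (1 : Zp) k = 1. Proof. by []. Qed.
Lemma padic_res_nat m k : (m%:R : Zp) k = m%:R.
Proof. by elim: m => // m IH; rewrite -!natr1 padic_resD IH. Qed.

Lemma padic_res_pow (x : Zp) m k : (k < m)%N -> (p%:R ^+ m * x) k = 0.
Proof.
move=> km; rewrite -natrX padic_resM padic_res_nat.
have -> : ((p ^ m)%:R : 'Z_(p ^ k.+1)) = 0; last by rewrite mul0r.
rewrite -(subnK km) expnD natrM pchar_Zp ?mulr0 //.
exact: (padic_pow_gt1 p_pr).
Qed.

Definition padic_partial (c : nat -> Zp) m : Zp := \sum_(k < m.+1) p%:R ^+ k * c k.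

Lemma padic_partial_coherent c :
  @padic_coherent p (fun m => padic_partial c m m).
Proof.
move=> m; rewrite padic_resP /padic_partial [in LHS]big_ord_recr padic_resD.
by rewrite padic_res_pow // addr0.
Qed.

Definition padic_sum (c : nat -> Zp) : Zp := PadicInt p_pr (padic_partial_coherent c).

Lemma padic_sumE c : padic_sum c = c 0%N + p%:R * padic_sum (fun k => c k.+1).
Proof.
apply: padic_intP => m; rewrite padic_resD padic_resM /= -padic_resM -padic_resD.
transitivity (padic_partial c m.+1 m).
  by rewrite {2}/padic_partial big_ord_recr padic_resD padic_res_pow ?addr0.
congr (padic_res _ m); rewrite /padic_partial big_ord_recl expr0 mul1r mulr_sumr.
by congr (_ + _); apply: eq_bigr => i _; rewrite mulrA -exprS.
Qed.

(** The base p digits: the top digit of the residue modulo p^(k+1). *)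
Definition padic_digit (x : Zp) k : Zp :=
  if k is k'.+1 then (x k %/ p ^ k)%:R else (x 0%N : nat)%:R.

Lemma padic_digit_sum (x : Zp) : x = padic_sum (padic_digit x).
Proof.
apply: padic_intP => m /=.
have -> : padic_partial (padic_digit x) m = (x m : nat)%:R.
  rewrite /padic_partial; elim: m => [|m IH].
    by rewrite big_ord1 mul1r.
  rewrite big_ord_recr IH /= -natrX -natrM -natrD.
  have <- : (x m.+1 %% p ^ m.+1 = x m)%N.
    by rewrite -(padic_resP x m) val_Zp_nat // (padic_pow_gt1 p_pr).
  by rewrite addnC mulnC -divn_eq.
by rewrite padic_res_nat natr_Zp.
Qed.

Lemma padic_div (x : Zp) : x 0%N = 0 -> exists y, x = p%:R * y.
Proof.
move=> x0; rewrite (padic_digit_sum x) padic_sumE /= x0 add0r.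
by eexists.
Qed.

Lemma padic_complete_dvr : @complete_dvr Zp p%:R.
Proof.
have res0 (y : Zp) : (p%:R * y) 0%N = 0 by rewrite -[p%:R]expr1 padic_res_pow.
split.
- by exists padic_sum; apply: padic_sumE.
- move=> x xP; apply: padic_intP => k; have [b ->] := xP k.+1.
  by rewrite padic_res_pow.
- apply/eqP => p0; have := congr1 (fun x : Zp => x 1%N) p0.
  rewrite padic_res_nat padic_res0 => /(congr1 val) /=.
  rewrite val_Zp_nat ?(padic_pow_gt1 p_pr) // modn_small.
    by move=> E; move: p_pr; rewrite E.
  by rewrite -[X in (X < _)%N]expn1 ltn_exp2l // prime_gt1.
- move=> y; apply/eqP => /(congr1 (fun x : Zp => x 0%N)).
  by rewrite res0 padic_res1 => /esym/eqP; rewrite oner_eq0.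
- move=> x; have [x0|x0] := eqVneq (x 0%N) 0; [left | right].
    exact: padic_div.
  have xu : x 0%N \is a GRing.unit.
    rewrite -(natr_Zp (x 0%N)) unitZpE ?(padic_pow_gt1 p_pr) // coprimeXl //.
    rewrite prime_coprime //; apply: contra x0 => /dvdnP[q xq].
    rewrite -(natr_Zp (x 0%N)) xq natrM.
    have -> : (p%:R : 'Z_(p ^ 1)) = 0 := pchar_Zp (padic_pow_gt1 p_pr 0).
    by rewrite mulr0.
  (* A natural number representing the inverse of x modulo p. *)
  pose a : Zp := ((x 0%N)^-1 : nat)%:R; exists a.
  have [|y E] := @padic_div (a * x - 1).
    by rewrite padic_resD padic_resM padic_res_nat natr_Zp mulVr // subrr.
  by exists y; rewrite -E addrC subrK.
Qed.

End PadicDvr.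

(** * Formal power series *)

Section FpsDvr.
Variable F : fieldType.
Local Notation fps := (fps F).

Lemma fps_coefD (f g : fps) k : (f + g) k = f k + g k. Proof. by []. Qed.
Lemma fps_coefM (f g : fps) k : (f * g) k = \sum_(i < k.+1) f i * g (k - i)%N.
Proof. by []. Qed.
Lemma fps_coef1 k : (1 : fps) k = (k == 0)%:R. Proof. by []. Qed.

Lemma fps_tM0 (g : fps) : (fps_t F * g) 0%N = 0.
Proof. by rewrite fps_coefM big_ord1 /= mul0r. Qed.

Lemma fps_tMS (g : fps) k : (fps_t F * g) k.+1 = g k.
Proof.
rewrite fps_coefM !big_ord_recl /= mul0r add0r mul1r subSS subn0.
by rewrite big1 ?addr0 // => i _; rewrite mul0r.
Qed.

Lemma fps_t_decomp (f c : fps) : f 0%N = c 0%N -> (forall k, c k.+1 = 0) ->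
  f = c + fps_t F * Fps (fun k => f k.+1).
Proof.
move=> f0 c0; apply: fpsP => -[|k]; rewrite fps_coefD ?fps_tM0 ?addr0 //.
by rewrite fps_tMS c0 add0r.
Qed.

Lemma fps_complete_dvr : complete_dvr (fps_t F).
Proof.
split.
(* The coefficient of t^m in the sum of the t^k c_k involves only k <= m. *)
- exists (fun c : nat -> fps => Fps (fun m => \sum_(k < m.+1) c k (m - k)%N)) => c.
  apply: fpsP => -[|m]; rewrite fps_coefD ?fps_tM0 ?fps_tMS /=.
    by rewrite big_ord1 addr0.
  by rewrite big_ord_recl subn0.
- move=> f fP; apply: fpsP => k; have [g ->] := fP k.+1.
  elim: k {fP} => [|k IH]; first by rewrite expr1 fps_tM0.
  by rewrite exprS -mulrA fps_tMS IH.
- apply/eqP => /(congr1 (fun f : fps => f 1%N)) /= /eqP.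
  by rewrite oner_eq0.
- move=> g; apply/eqP => /(congr1 (fun f : fps => f 0%N)).
  by rewrite fps_tM0 fps_coef1 => /esym/eqP; rewrite oner_eq0.
- move=> f; have [f0|f0] := eqVneq (f 0%N) 0; [left | right].
    by exists (Fps (fun k => f k.+1)); rewrite {1}(@fps_t_decomp f 0) // add0r.
  pose a : fps := Fps (fun k => if k is 0 then (f 0%N)^-1 else 0).
  exists a, (Fps (fun k => (a * f) k.+1)); apply: fps_t_decomp => //.
  by rewrite fps_coefM big_ord1 /= mulVf.
Qed.

End FpsDvr.

(** * Finite extensions *)

Section Extension.
Variables (D : idomainType) (pi : D) (L : fieldType) (f : {rmorphism D -> L}).
Hypotheses (DP : complete_dvr pi) (f_inj : injective f).

Definition int_closure : set L := [set x | integralOver f x].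
Local Notation O := int_closure.

Definition adjoin_ring (x : L) : set L := [set y | exists q, y = (map_poly f q).[x]].

Lemma int_closure_subring : is_subring O.
Proof.
split; first exact: integral1.
- by move=> x y; apply: integral_sub.
- by move=> x y; apply: integral_mul.
Qed.
Let sO := int_closure_subring.

Lemma int_closure_img z : O (f z). Proof. exact: integral_id. Qed.

Lemma adjoin_subring x : is_subring (adjoin_ring x).
Proof.
split.
- by exists 1; rewrite rmorph1 hornerC.
- by move=> _ _ [q ->] [r ->]; exists (q - r); rewrite rmorphB hornerD hornerN.
- by move=> _ _ [q ->] [r ->]; exists (q * r); rewrite rmorphM hornerM.
Qed.

Lemma adjoin_img x z : adjoin_ring x (f z).
Proof. by exists z%:P; rewrite map_polyC hornerC. Qed.

Lemma adjoin_gen x : adjoin_ring x x.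
Proof. by exists 'X; rewrite map_polyX hornerX. Qed.

Lemma adjoin_min (B : set L) x : is_subring B -> (forall z, B (f z)) -> B x ->
  adjoin_ring x `<=` B.
Proof.
move=> sB Bf Bx _ [q ->]; elim/poly_ind: q => [|q c IH].
  by rewrite rmorph0 horner0; subring.
rewrite rmorphD rmorphM /= map_polyX map_polyC hornerD hornerMX hornerC.
by have Bc := Bf c; subring.
Qed.

Lemma adjoin_integral x : O x -> adjoin_ring x `<=` O.
Proof. by apply: adjoin_min => //; apply: int_closure_img. Qed.

(** Multiply the monic relation for x^-1, of degree d + 1, by x^d. *)
Lemma adjoin_inv x : x != 0 -> O x^-1 -> adjoin_ring x x^-1.
Proof.
move=> x0 [P Pm /rootP Px].
have [d dE] : exists d, size P = d.+1.
  by exists (size P).-1; rewrite prednK // size_poly_gt0 monic_neq0.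
have Pd : P`_d = 1 by have := monicP Pm; rewrite /lead_coef dE.
move: Px; rewrite horner_coef size_map_inj_poly ?rmorph0 // dE.
case: d {dE} Pd => [|d] Pd.
  by rewrite big_ord1 coef_map /= Pd rmorph1 mulr1 => /eqP; rewrite oner_eq0.
rewrite big_ord_recr coef_map /= Pd rmorph1 mul1r => /eqP.
rewrite addr_eq0 => /eqP E.
exists (- \sum_(i < d.+1) P`_i *: 'X^(d - i)).
rewrite rmorphN hornerN rmorph_sum horner_sum.
apply: (mulIf (expf_neq0 d (invr_neq0 x0))); rewrite -exprS mulNr mulr_suml.
apply/eqP; rewrite -eqr_oppLR -E; apply/eqP/eq_bigr => i _.
rewrite coef_map /= map_polyZ map_polyXn hornerZ hornerXn -mulrA; congr (_ * _).
have le_id : (i <= d)%N by rewrite -ltnS.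
rewrite -[in X in _ = _ * _ ^+ X](subnK le_id) exprD mulrA -exprMn mulfV //.
by rewrite expr1n mul1r.
Qed.

(** An integral 1 / pi would lie in D[pi] = D, where pi is not invertible. *)
Lemma pi_nonunit : ~ O (f pi)^-1.
Proof.
have [_ _ pi0 pi1 _] := DP.
have fpi0 : f pi != 0 by rewrite -(rmorph0 f) (inj_eq f_inj).
move=> /(adjoin_inv fpi0)[q]; rewrite horner_map => E.
have /negP[] := pi1 q.[pi]; apply/eqP/f_inj.
by rewrite rmorphM rmorph1 -E mulfV.
Qed.

Lemma pi_valuation z : z != 0 -> exists v c, z = pi ^+ v * c /\ exists c', c' * c = 1.
Proof.
have [_ sep _ _ _] := DP; move=> z0.
pose Q m := `[< ~ exists b, z = pi ^+ m * b >].
have exQ : exists m, Q m.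
  apply: contrapT => h; case/eqP: z0; apply: sep => m; apply: contrapT => h'.
  by apply: h; exists m; apply/asboolP.
case: (ex_minnP exQ) => -[|v] /asboolP vN vmin.
  by case: vN; exists z; rewrite mul1r.
have [c cE] : exists c, z = pi ^+ v * c.
  apply: contrapT => h; have := vmin v; rewrite ltnn => /implyP.
  by rewrite implybF => /negP; apply; apply/asboolP.
exists v, c; split=> //; apply: (complete_dvr_unit DP) => y cy.
by apply: vN; exists y; rewrite cE cy mulrA -exprSr.
Qed.

(** A substitute for the norm: after removing powers of X from a monic relation, its non-zero
    constant term is a multiple of x. *)
Lemma integral_norm x : O x -> x != 0 -> exists y z, [/\ O y, z != 0 & x * y = f z].
Proof.
move=> Ox x0; have [P Pm Px] := Ox.
have P0 : P != 0 := monic_neq0 Pm.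
have [m [q /implyP/(_ P0) q0 PE]] := multiplicity_XsubC P 0.
have qx : (map_poly f q).[x] = 0.
  move: Px; rewrite /root PE rmorphM rmorphXn rmorphB /= map_polyX map_polyC.
  rewrite /= rmorph0 subr0 hornerM horner_exp hornerX mulf_eq0.
  by rewrite expf_eq0 (negPf x0) andbF orbF => /eqP.
have /factor_theorem[r rE] : root (q - (q.[0])%:P) 0.
  by rewrite /root hornerD hornerN hornerC subrr.
exists (- (map_poly f r).[x]), q.[0]; split=> //.
  by have : O (map_poly f r).[x]; [apply: (adjoin_integral Ox); exists r | move=> ?; subring].
have := congr1 (fun s => (map_poly f s).[x]) rE.
rewrite rmorphB rmorphM rmorphB /= map_polyX !map_polyC /= rmorph0 subr0.
rewrite hornerD hornerN hornerC qx hornerMX sub0r => E.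
by rewrite mulrN mulrC -E opprK.
Qed.

(** A non-zero x divides some non-zero z of D, of valuation v say. Divisibility of x by pi^(v+1)
    would make pi divide a unit of D inside O. *)
Lemma int_closure_separated : adic_separated O (f pi).
Proof.
move=> x xP; apply/eqP; apply: contrapT => /negP x0.
have Ox : O x by have [b Ob ->] := xP 0%N; rewrite mul1r.
have [y [z [Oy z0 xy]]] := integral_norm Ox x0.
have [v [c [zE [c' cc]]]] := pi_valuation z0.
have [_ _ pi0 _ _] := DP.
have fpi0 : f pi != 0 by rewrite -(rmorph0 f) (inj_eq f_inj).
apply: pi_nonunit; have [b Ob xE] := xP v.+1.
have -> : (f pi)^-1 = b * y * f c'.
  apply: (mulfI fpi0); rewrite mulfV //.
  have E : f c = f pi * (b * y).
    apply: (mulfI (expf_neq0 v fpi0)).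
    by rewrite -rmorphXn -rmorphM -zE -xy xE rmorphXn exprSr; ring.
  by rewrite mulrA -E -rmorphM mulrC cc rmorph1.
by have := int_closure_img c' => ?; subring.
Qed.

(** Reduction modulo the monic relation P bounds the number of coefficients, so series are summed
    coefficient by coefficient in D. *)
Lemma adjoin_complete x : O x -> adic_complete (adjoin_ring x) (f pi).
Proof.
move=> [P Pm /rootP Px] a aA; have [S SE] := adic_sum DP.
pose d := size P.
have /choice[q qP] : forall k, exists q : {poly D},
    (size q <= d)%N /\ a k = (map_poly f q).[x].
  move=> k; have [q ->] := aA k; exists (Pdiv.CommonRing.rmodp q P); split.
    by rewrite ltnW // Pdiv.Ring.ltn_rmodp monic_neq0.
  rewrite {1}(Pdiv.RingMonic.rdivp_eq Pm q) rmorphD rmorphM hornerD hornerM Px.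
  by rewrite mulr0 add0r.
pose W m := \poly_(i < d) S (fun k => (q (m + k)%N)`_i).
exists (map_poly f (W 0)).[x] => m; exists (map_poly f (W m)).[x]; first by exists (W m).
have -> : W 0 = \sum_(k < m) (pi ^+ k) *: q k + pi ^+ m *: W m.
  apply/polyP => i; rewrite coefD coefZ coef_sum !coef_poly.
  case: ltnP => id; last first.
    rewrite mulr0 addr0 big1 // => k _; rewrite coefZ nth_default ?mulr0 //.
    by rewrite (leq_trans (qP k).1).
  rewrite (SE _ m); congr (_ + _); apply: eq_bigr => k _.
  by rewrite coefZ.
rewrite rmorphD hornerD /= map_polyZ hornerZ rmorphXn rmorph_sum horner_sum.
congr (_ + _); apply: eq_bigr => k _; rewrite /= map_polyZ hornerZ rmorphXn.
by rewrite (qP k).2.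
Qed.

Variable rho : L.
Hypotheses (rhoU : uniformizer O rho).

Lemma pi_rho : exists2 o, O o & f pi = rho * o.
Proof.
apply: (uniformizer_mem rhoU); split; first exact: int_closure_img.
by move=> [_ _]; apply: pi_nonunit.
Qed.

(* Reduce a monic relation for eps modulo pi: after factoring out the lowest
   power eps^N with unit coefficient, the cofactor is a unit since eps lies in
   the maximal ideal. *)
Lemma adjoin_nilpotent eps eo : O eps -> O eo -> eps = rho * eo ->
  exists N b, adjoin_ring eps b /\ eps ^+ N = f pi * b.
Proof.
move=> Oe Oeo epsE; have [P Pm Px] := Oe; have [_ _ _ pi1 _] := DP.
pose Q m := `[< ~ exists y, P`_m = pi * y >].
have exQ : exists m, Q m.
  exists (size P).-1; apply/asboolP => -[y]; rewrite -lead_coefE (monicP Pm).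
  by move=> /esym/eqP; apply/negP/pi1.
case: (ex_minnP exQ) => i /asboolP iN imin.
have /choice[c cE] : forall k, exists c, (k < i)%N -> P`_k = pi * c.
  move=> k; have [ki|ik] := ltnP k i; last by exists 0.
  apply: contrapT => h; have : ~~ (i <= k)%N by rewrite -ltnNge.
  move/negP; apply; apply: imin; apply/asboolP => -[y yE].
  by apply: h; exists y.
have [c' c'P] : exists c', c' * P`_i = 1.
  by apply: (complete_dvr_unit DP) => y yE; apply: iN; exists y.
pose P1 := \poly_(k < i) c k; pose P2 := drop_poly i P.
have PE : P = pi *: P1 + P2 * 'X^i.
  rewrite -{1}(poly_take_drop i P); congr (_ + _); apply/polyP => k.
  by rewrite coefZ coef_take_poly coef_poly; case: ltnP => [/cE//|_]; rewrite mulr0.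
have /factor_theorem[r rE] : root (P2 - (P2.[0])%:P) 0.
  by rewrite /root hornerD hornerN hornerC subrr.
have P20 : P2.[0] = P`_i by rewrite horner_coef0 coef_drop_poly add0n.
pose a := (map_poly f P2).[eps].
have aE : a = f P`_i + eps * (map_poly f r).[eps].
  have := congr1 (fun s => (map_poly f s).[eps]) rE.
  rewrite rmorphB rmorphM rmorphB /= map_polyX !map_polyC /= rmorph0 subr0.
  rewrite hornerD hornerN hornerC hornerMX -/a P20 => E.
  by rewrite mulrC -E addrC subrK.
have Or : O (map_poly f r).[eps] by apply: (adjoin_integral Oe); exists r.
have Oc' := int_closure_img c'.
have Ox : O (eo * f c' * (map_poly f r).[eps]) by subring.
have uE : f c' * a = 1 + rho * (eo * f c' * (map_poly f r).[eps]).
  by rewrite aE mulrDr -rmorphM c'P rmorph1 {1}epsE; ring.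
have Ou := uniformizer_unit sO rhoU Ox.
have rho0 : rho != 0.
  have [o _ oE] := pi_rho; have [_ _ pi0 _ _] := DP.
  by apply: contra_neq pi0 => r0; apply: f_inj; rewrite rmorph0 oE r0 mul0r.
have u0 := unit1_neq0 sO rho0 (uniformizerV sO rhoU rho0) Ox.
have a0 : a != 0 by apply: contraNneq u0 => a0; rewrite -uE a0 mulr0.
have OaV : O a^-1.
  have -> : a^-1 = f c' * (f c' * a)^-1.
    have fc0 : f c' != 0 by apply: contraNneq u0 => h; rewrite -uE h mul0r.
    by rewrite invfM mulrA mulfV ?mul1r.
  by rewrite uE; subring.
have sA := adjoin_subring eps.
have Aa : adjoin_ring eps a by exists P2.
(* As 1 / a is integral, it lies in D[a], which is contained in D[eps]. *)
have AaV : adjoin_ring eps a^-1.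
  apply: (@adjoin_min _ a sA (adjoin_img eps) Aa).
  exact: adjoin_inv.
have A1 : adjoin_ring eps (map_poly f P1).[eps] by exists P1.
exists i, (- ((map_poly f P1).[eps] * a^-1)); split; first by subring.
move: Px; rewrite /root PE rmorphD rmorphM /= map_polyZ map_polyXn hornerD.
rewrite hornerZ hornerM hornerXn -/a addrC addr_eq0 => /eqP E.
apply: (mulfI a0); rewrite E; field.
exact: a0.
Qed.

(** Completeness of D[eps] comes from the integral equation of eps alone; separatedness is inherited
    from O. *)
Lemma extension_config n eps e o : (2 <= n)%N -> O o ->
  eps = rho ^+ e.+1 * (1 + rho * o) -> rho != 0 ->
  eps ^+ 2 != 1 /\ exists u, root_config n eps (phase_class O rho) u.
Proof.
move=> hn Oo epsE rho0; have Or := uniformizer_int sO rhoU.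
have rV := uniformizerV sO rhoU rho0; have ru := @uniformizer_unit _ _ _ sO rhoU.
have Oeo : O (rho ^+ e * (1 + rho * o)) by subring.
have epsE' : eps = rho * (rho ^+ e * (1 + rho * o)) by rewrite epsE exprS mulrA.
have Oe : O eps by rewrite epsE'; subring.
have [N [b [Ab epsN]]] := adjoin_nilpotent Oe Oeo epsE'.
have [po Opo piE] := pi_rho.
have AO := adjoin_integral Oe.
have eps0 : eps != 0.
  by rewrite epsE mulf_neq0 ?expf_neq0 // (unit1_neq0 sO rho0 rV).
have epsP : phase_class O rho eps by exists e.+1%:Z, o.
have As : adic_separated (adjoin_ring eps) (f pi).
  move=> x xP; apply: int_closure_separated => m.
  by have [c /AO Oc ->] := xP m; exists c.
split; first exact: (nonarch_eps2 sO rho0 rV AO (adjoin_gen eps) Oeo epsE').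
exact: (nonarch_config sO Or rho0 rV ru hn (adjoin_subring eps) AO (adjoin_gen eps)
  (adjoin_img eps pi) Ab epsN Oeo Opo epsE' piE eps0 epsP (adjoin_complete Oe) As).
Qed.

End Extension.

(** * Fraction fields of complete discrete valuation rings *)

Section FractionConfig.
Variables (D : idomainType) (pi : D) (n : nat).
Hypotheses (DP : complete_dvr pi) (hn : (2 <= n)%N).
Local Notation O := (@frac_integers D).
Let sO := frac_integers_subring D.
Let Opi : O (tofrac pi). Proof. by exists pi. Qed.

Lemma fraction_config rho eps e o : uniformizer O rho -> rho != 0 -> O o ->
  eps = rho ^+ e.+1 * (1 + rho * o) ->
  eps ^+ 2 != 1 /\ exists u, root_config n eps (phase_class O rho) u.
Proof.
move=> rhoU rho0 Oo epsE; have Or := uniformizer_int sO rhoU.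
have rV := uniformizerV sO rhoU rho0; have ru := @uniformizer_unit _ _ _ sO rhoU.
have Oeo : O (rho ^+ e * (1 + rho * o)) by subring.
have epsE' : eps = rho * (rho ^+ e * (1 + rho * o)) by rewrite epsE exprS mulrA.
have Oe : O eps by rewrite epsE'; subring.
have [b Ob epsb] : exists2 b, O b & eps = tofrac pi * b.
  by apply: (frac_nonunit DP); rewrite epsE'; apply: (maximal_ideal_rho rhoU).
have [po Opo piE] : exists2 po, O po & tofrac pi = rho * po.
  apply: (uniformizer_mem rhoU); split=> //.
  by move=> [_ _]; apply: (frac_piV DP).
have eps0 : eps != 0.
  by rewrite epsE mulf_neq0 ?expf_neq0 // (unit1_neq0 sO rho0 rV).
have epsP : phase_class O rho eps by exists e.+1%:Z, o.
have epsN : eps ^+ 1 = tofrac pi * b by rewrite expr1.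
split; first exact: (nonarch_eps2 sO rho0 rV (fun x => id) Oe Oeo epsE').
exact: (nonarch_config sO Or rho0 rV ru hn sO (fun x => id) Oe
  Opi Ob epsN Oeo Opo epsE' piE eps0 epsP
  (frac_integers_complete DP) (frac_integers_separated DP)).
Qed.

(** The case eps = rho = pi, N = 1, with the conditions on rho checked directly for pi. *)
Lemma fraction_pi_config :
  tofrac pi ^+ 2 != 1
  /\ exists u, root_config n (tofrac pi) (phase_class O (tofrac pi)) u.
Proof.
have rho0 := frac_pi_neq0 DP; have rV := frac_piV DP; have ru := @frac_pi_unit _ _ DP.
have O1 := is_subring1 sO; have piE : tofrac pi = tofrac pi * 1 by rewrite mulr1.
have piN : tofrac pi ^+ 1 = tofrac pi * 1 by rewrite mulr1.
have piP : phase_class O (tofrac pi) (tofrac pi).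
  by exists 1, 0; [subring | rewrite mulr0 addr0 mulr1].
split; first exact: (nonarch_eps2 sO rho0 rV (fun x => id) Opi O1 piE).
exact: (nonarch_config sO Opi rho0 rV ru hn sO (fun x => id) Opi
  Opi O1 piN O1 O1 piE piE rho0 piP
  (frac_integers_complete DP) (frac_integers_separated DP)).
Qed.

Lemma fraction_pi_card :
  let S := nondeg_roots (Gsys n (tofrac pi))
             `&` [set x : 'rV[{fraction D}]_n | forall j : 'I_n, x ord0 j != 0] in
  (S #= `I_n.+1)%card /\
  forall x, S x -> forall j : 'I_n, na_phase_one O (tofrac pi) (x ord0 j).
Proof.
have rho0 := frac_pi_neq0 DP; have rV := frac_piV DP; have ru := @frac_pi_unit _ _ DP.
have [pi2 [u uC]] := fraction_pi_config.
have PhG := phase_class_subgroup sO Opi rho0 rV ru.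
have [cS SP] := card_config hn rho0 pi2 PhG uC (@mult_subgroup_neq0 _ _ PhG).
split=> // x /SP xP j; exact: (phase_class_one sO Opi rho0 rV ru (xP j)).
Qed.

End FractionConfig.

(** * Archimedean phases and conclusion *)

Lemma gt0_subgroup (K : numFieldType) : mult_subgroup (fun x : K => 0 < x).
Proof.
split; [exact: ltr01 | by rewrite ltxx | exact: mulr_gt0 |].
by move=> x; rewrite invr_gt0.
Qed.

Lemma arch_phase_gt0 (K : numFieldType) (y : K) : y != 0 ->
  arch_phase_one y <-> 0 < y.
Proof.
move=> y0; rewrite /arch_phase_one /arch_phase; split=> [E|y_gt0].
  by rewrite -[y]divr1 -[1]E invf_div mulrCA divff // mulr1 normr_gt0.
by rewrite gtr0_norm // divff.
Qed.

(** Positive elements in the order of [R[i]] are the positive reals, so the real family is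
    transported unchanged. *)
Lemma complex_config (R : rcfType) (n : nat) (eps : R) :
  (2 <= n)%N -> 0 < eps -> 4 * eps <= 1 ->
  exists u, root_config n (eps%:C)%C (fun x : R[i] => 0 < x) u.
Proof.
move=> hn e0 e4; have [u [u_inj u_root uP]] := real_config hn e0 e4.
exists (fun k => (u k)%:C)%C; split.
- by move=> j k jn kn /complexI; apply: u_inj.
- move=> k kn; rewrite -(map_eliminant (real_complex R)) rmorph_root //.
  exact: u_root.
- move=> k i kn il; rewrite -(map_facval (real_complex R)) ltcR.
  exact: uP.
Qed.

Lemma arch_eps2 (K : numFieldType) (eps : K) : 0 < eps -> 4 * eps <= 1 ->
  eps ^+ 2 != 1.
Proof.
move=> e0 e4; rewrite lt_eqF // exprn_ilt1 // ?ltW //.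
rewrite -(ltr_pM2l (x := 4)) ?ltr0n // (le_lt_trans e4) //.
by rewrite mulr1 ltr1n.
Qed.

Lemma ln_lt_quarter (R : realType) (r : R) : 0 < r -> ln 4 < - ln r -> 4 * r <= 1.
Proof.
move=> r0; rewrite ltrNr -lnV ?posrE ?ltr0n // ltr_ln ?posrE ?invr_gt0 ?ltr0n //.
by move=> h; rewrite -ler_pdivlMl ?ltr0n // mulr1 ltW.
Qed.

Lemma config_conclusion (K : fieldType) (n : nat) (eps : K) (Ph P : K -> Prop) u :
  (2 <= n)%N -> eps != 0 -> eps ^+ 2 != 1 -> mult_subgroup Ph ->
  root_config n eps Ph u -> (forall x, Ph x -> P x) ->
  forall (E : fieldType) (f : {rmorphism K -> E}) (x : 'rV[E]_n),
  sys_root (map_system f (Gsys n eps)) x ->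
  nondegenerate_at (map_system f (Gsys n eps)) x /\
  exists y : 'rV[K]_n, x = map_mx f y /\
    forall j : 'I_n, y ord0 j != 0 /\ P (y ord0 j).
Proof.
move=> hn e0 e2 PhG uC PhP E f x Gx.
have [ndeg [k kn xE]] := config_all_roots hn e0 e2 uC Gx.
split=> //; exists (sol n eps (u k)); split=> // j.
have Pj := sol_config PhG uC j kn.
by split; [exact: (mult_subgroup_neq0 PhG) | exact: PhP].
Qed.

Theorem theorem1p6 (R : realType) (n : nat) (hn : (2 <= n)%N) :
  (forall L : local_field R,
     (forall eps : L, eps != 0 -> nomial_system (n + 2) (Gsys n eps)) /\
     exists B : R, forall (rho : phase_choice L) (eps : L),
       eps != 0 -> phase_one rho eps -> B < local_ord rho eps ->
       forall (Lbar : closedFieldType) (iota : {rmorphism L -> Lbar}),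
         (forall z : Lbar, algebraicOver iota z) ->
         forall x : 'rV[Lbar]_n, sys_root (map_system iota (Gsys n eps)) x ->
           nondegenerate_at (map_system iota (Gsys n eps)) x /\
           exists y : 'rV[L]_n, x = map_mx iota y /\
             forall j : 'I_n, y ord0 j != 0 /\ phase_one rho (y ord0 j))
  /\
  (let S := nondeg_roots (Gsys n (4%:R^-1 : R))
              `&` [set x : 'rV[R]_n | forall j : 'I_n, 0 < x ord0 j] in
   (S #= `I_n.+1)%card /\
   forall x, S x -> forall j : 'I_n, arch_phase_one (x ord0 j))
  /\
  (forall (p : nat) (p_pr : prime p),
     let S := nondeg_roots (Gsys n (p%:R : padic p_pr))
                `&` [set x : 'rV[padic p_pr]_n | forall j : 'I_n, x ord0 j != 0] in
     (S #= `I_n.+1)%card /\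
     forall x, S x -> forall j : 'I_n,
       na_phase_one (@padic_integers p p_pr) p%:R (x ord0 j))
  /\
  (forall F : finFieldType,
     let t : laurent F := tofrac (fps_t F) in
     let S := nondeg_roots (Gsys n t)
                `&` [set x : 'rV[laurent F]_n | forall j : 'I_n, x ord0 j != 0] in
     (S #= `I_n.+1)%card /\
     forall x, S x -> forall j : 'I_n,
       na_phase_one (@laurent_integers F) t (x ord0 j)).
Proof.
split; first case=> [||p p_pr L|F]; [..|split; [|split]].
- split=> [eps eps0|]; first exact: nomial_Gsys.
  (* An order above ln 4 means |eps| < 1/4. *)
  exists (ln 4) => -[] eps e0 /(arch_phase_gt0 e0) e_gt0 /= leps Lbar iota _ x.
  have e4 : 4 * eps <= 1.
    by apply: ln_lt_quarter => //; rewrite -{1}(gtr0_norm e_gt0).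
  have [u uC] := real_config hn e_gt0 e4.
  apply: (config_conclusion hn e0 (arch_eps2 e_gt0 e4) (gt0_subgroup R) uC) => y y0.
  by apply/arch_phase_gt0; rewrite ?gt_eqF.
- split=> [eps eps0|]; first exact: nomial_Gsys.
  exists (ln 4) => -[] eps e0 /(arch_phase_gt0 e0) e_gt0 leps Lbar iota _ x.
  (* Phase one makes eps a positive real, which reduces to the real family. *)
  have [r epsE] : exists r : R, eps = (r%:C)%C.
    by exists (complex.Re eps); rewrite RRe_real // gtr0_real.
  move: e0 e_gt0 leps; rewrite {}epsE /local_ord => e0 e_gt0; rewrite gtr0_norm // => leps.
  have r_gt0 : 0 < r by move: e_gt0; rewrite ltcR.
  have r4 := ln_lt_quarter r_gt0 leps.
  have r2 : (r%:C)%C ^+ 2 != 1 :> R[i].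
    by rewrite -(rmorphXn (real_complex R)) fmorph_eq1 arch_eps2.
  have [u uC] := complex_config hn r_gt0 r4.
  apply: (config_conclusion hn e0 r2 (gt0_subgroup R[i]) uC) => y y0.
  by apply/arch_phase_gt0; rewrite ?gt_eqF.
- split=> [eps eps0|]; first exact: nomial_Gsys.
  (* Positive order suffices, for every uniformizer. *)
  exists 0 => -[rho rhoU] eps e0 eP /=; rewrite ltr0z => ord_gt0 Lbar iota _ x.
  pose f : {rmorphism padic_int p_pr -> L} := in_alg L \o @tofrac (padic_int p_pr).
  have f_inj : injective f by move=> y z /fmorph_inj/tofrac_inj.
  have sO := int_closure_subring f.
  have [rho0 [e [o [Oo epsE]]]] := phase_one_ord_gt0 sO rhoU eP ord_gt0.
  have [e2 [u uC]] :=
    extension_config (padic_complete_dvr p_pr) f_inj rhoU hn Oo epsE rho0.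
  have Or := uniformizer_int sO rhoU; have rV := uniformizerV sO rhoU rho0.
  have ru := @uniformizer_unit _ _ _ sO rhoU.
  apply: (config_conclusion hn e0 e2 (phase_class_subgroup sO Or rho0 rV ru) uC) => y.
  exact: phase_class_one.
- split=> [eps eps0|]; first exact: nomial_Gsys.
  exists 0 => -[rho rhoU] eps e0 eP /=; rewrite ltr0z => ord_gt0 Lbar iota _ x.
  have sO := frac_integers_subring (fps F).
  have [rho0 [e [o [Oo epsE]]]] := phase_one_ord_gt0 sO rhoU eP ord_gt0.
  have [e2 [u uC]] := fraction_config (fps_complete_dvr F) hn rhoU rho0 Oo epsE.
  have Or := uniformizer_int sO rhoU; have rV := uniformizerV sO rhoU rho0.
  have ru := @uniformizer_unit _ _ _ sO rhoU.
  apply: (config_conclusion hn e0 e2 (phase_class_subgroup sO Or rho0 rV ru) uC) => y.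
  exact: phase_class_one.
- have e_gt0 : 0 < 4%:R^-1 :> R by rewrite invr_gt0 ltr0n.
  have e0 : 4%:R^-1 != 0 :> R by rewrite gt_eqF.
  have e4 : 4 * 4%:R^-1 <= 1 :> R by rewrite mulfV // pnatr_eq0.
  have [u uC] := real_config hn e_gt0 e4.
  have [cS SP] := card_config hn e0 (arch_eps2 e_gt0 e4) (gt0_subgroup R) uC (fun x => id).
  by split=> // x /SP xP j; apply/arch_phase_gt0; rewrite ?gt_eqF.
- move=> p p_pr; have := fraction_pi_card (padic_complete_dvr p_pr) hn.
  by rewrite rmorph_nat.
- by move=> F; apply: (fraction_pi_card (fps_complete_dvr F) hn).
Qed.
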